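(* Let $\mathcal F$ be a set of $2$-edge-coloured graphs on three vertices. Suppose that ${}^{rb}P_3\in\mathcal F$ or $\{{}^rP_3,{}^bP_3\}\subseteq\mathcal F$, and that the set of triangles in $\mathcal F$ is $\{{}^rK_3,{}^{rbb}K_3\}$ or $\{{}^bK_3,{}^{rrb}K_3\}$. Then the $\mathcal F$-free colouring problem can be solved via linear equations over $\mathbb Z_2$; that is, from an input graph $G$ one can construct in polynomial time a system of linear equations over $\mathbb Z_2$ that is solvable if and only if $G$ admits an $\mathcal F$-free $2$-edge-colouring.
   Context: Graphs are finite and simple. A $2$-edge-colouring of $G$ assigns to every edge the colour red or blue (not necessarily properly). For a set $\mathcal F$ of $2$-edge-coloured graphs, a $2$-edge-colouring of $G$ is $\mathcal F$-free if no induced $2$-edge-coloured subgraph is isomorphic (preserving colours) to a member of $\mathcal F$. The $\mathcal F$-free colouring problem is to decide whether an input graph $G$ admits an $\mathcal F$-free $2$-edge-colouring. The $2$-edge-coloured graphs on three vertices are: the edgeless graph $3K_1$; the one-edge graph with a red or with a blue edge; ${}^rP_3$, ${}^bP_3$, ${}^{rb}P_3$, the path on three vertices with both edges red, both edges blue, or one edge of each colour; ${}^rK_3$, ${}^bK_3$, ${}^{rrb}K_3$, ${}^{rbb}K_3$, the triangle with all edges red, all edges blue, two red and one blue, or one red and two blue edges, respectively. *)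

(* Defs.v *)
From mathcomp Require Import all_boot all_order all_algebra.

Set Implicit Arguments.
Unset Strict Implicit.
Unset Printing Implicit Defensive.

Record sgraph (V : finType) := SGraph {
  edge :> rel V;
  edge_sym : symmetric edge;
  edge_irr : irreflexive edge
}.

Inductive colour := Red | Blue.

(* [ecol K u v] is [Some c] if uv is an edge of colour c, and [None] if u and
   v are not adjacent. *)
Record ecgraph (V : finType) := ECGraph {
  ecol :> V -> V -> option colour;
  ecol_sym : forall u v, ecol u v = ecol v u;
  ecol_irr : forall u, ecol u u = None
}.

Definition colouring_of (V : finType) (G : sgraph V) (K : ecgraph V) : Prop :=
  forall u v, isSome (K u v) = G u v.

Definition ec_iso (V W : finType) (K : ecgraph V) (H : ecgraph W) : Prop :=
  exists2 f : V -> W, bijective f & forall u v, H (f u) (f v) = K u v.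

Definition ec_induced (V : finType) (K : ecgraph V) (S : {set V}) :
  ecgraph {x : V | x \in S} :=
  @ECGraph {x : V | x \in S} (fun u v => K (val u) (val v))
    (fun u v => ecol_sym K (val u) (val v)) (fun u => ecol_irr K (val u)).

Definition ecgraph3 := ecgraph 'I_3.

Definition F_free (F : ecgraph3 -> Prop) (V : finType) (K : ecgraph V) : Prop :=
  forall (S : {set V}) (H : ecgraph3), F H -> ~ ec_iso (ec_induced K S) H.

Definition F_free_colourable (F : ecgraph3 -> Prop) (V : finType)
    (G : sgraph V) : Prop :=
  exists K : ecgraph V, colouring_of G K /\ F_free F K.

(* The 2-edge-coloured graph on {0, 1, 2} in which 01, 12 and 02 have status
   a, b and c respectively; the sum i + j identifies the pair {i, j}. *)
Definition ec3_fun (a b c : option colour) (i j : 'I_3) : option colour :=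
  if i == j then None else
  match i + j with 1 => a | 3 => b | _ => c end.

Fact ec3_sym a b c i j : ec3_fun a b c i j = ec3_fun a b c j i.
Proof. by rewrite /ec3_fun eq_sym addnC. Qed.

Fact ec3_irr a b c i : ec3_fun a b c i i = None.
Proof. by rewrite /ec3_fun eqxx. Qed.

Definition ec3 (a b c : option colour) : ecgraph3 :=
  ECGraph (ec3_sym a b c) (ec3_irr a b c).

Definition rP3  : ecgraph3 := ec3 (Some Red) (Some Red) None.
Definition bP3  : ecgraph3 := ec3 (Some Blue) (Some Blue) None.
Definition rbP3 : ecgraph3 := ec3 (Some Red) (Some Blue) None.

Definition rK3   : ecgraph3 := ec3 (Some Red) (Some Red) (Some Red).
Definition bK3   : ecgraph3 := ec3 (Some Blue) (Some Blue) (Some Blue).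
Definition rrbK3 : ecgraph3 := ec3 (Some Red) (Some Red) (Some Blue).
Definition rbbK3 : ecgraph3 := ec3 (Some Red) (Some Blue) (Some Blue).

(* Coloured graphs are considered up to colour-preserving isomorphism, so
   membership in F means being isomorphic to some member of F. *)
Definition ec_mem (H : ecgraph3) (F : ecgraph3 -> Prop) : Prop :=
  exists2 H', F H' & ec_iso H H'.

Definition is_triangle (H : ecgraph3) : Prop :=
  forall i j : 'I_3, i != j -> isSome (H i j).

Definition triangles_are (F : ecgraph3 -> Prop) (T1 T2 : ecgraph3) : Prop :=
  forall H : ecgraph3, is_triangle H ->
    (ec_mem H F <-> ec_iso H T1 \/ ec_iso H T2).

Record z2system := Z2System {
  neqs : nat;
  nvars : nat;
  lhs : 'M['F_2]_(neqs, nvars);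
  rhs : 'cV['F_2]_neqs
}.

Definition z2_solvable (S : z2system) : Prop :=
  exists x : 'cV['F_2]_(nvars S), (lhs S *m x = rhs S)%R.

(* Deterministic multi-tape Turing machines with tape alphabet {0, 1, blank},
   [None] being the blank symbol. Tapes are infinite in both directions; a tape
   is given by the cells to the left of the head (nearest first), the scanned
   cell and the cells to its right, all cells beyond being blank. *)
Definition sym := option bool.

Inductive move := MoveL | MoveR | Stay.

Record tape := Tape { tleft : seq sym; thead : sym; tright : seq sym }.

Definition tape_act (a : sym * move) (t : tape) : tape :=
  let: Tape l _ r := t in
  match a.2 with
  | MoveL => Tape (behead l) (head None l) (a.1 :: r)
  | MoveR => Tape (a.1 :: l) (head None r) (behead r)
  | Stay => Tape l a.1 r
  end.

Definition blank_tape : tape := Tape [::] None [::].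

Definition word_tape (w : seq bool) : tape :=
  Tape [::] (head None (map Some w)) (behead (map Some w)).

Fixpoint blank_free_prefix (s : seq sym) : seq bool :=
  if s is Some b :: s' then b :: blank_free_prefix s' else [::].

(* The word starting at the head and ending before the first blank. *)
Definition tape_word (t : tape) : seq bool :=
  blank_free_prefix (thead t :: tright t).

Record TM := MkTM {
  extra_tapes : nat;
  ntapes := extra_tapes.+2;
  state : finType;
  start : state;
  halting : pred state;
  trans : state -> {ffun 'I_ntapes -> sym} ->
          state * ('I_ntapes -> sym * move)
}.

Record config (M : TM) := Config {
  cstate : state M;
  ctapes : 'I_(ntapes M) -> tape
}.

Definition TM_step (M : TM) (c : config M) : config M :=
  if halting (cstate c) then c else
  let: (q, act) := trans (cstate c) [ffun i => thead (ctapes c i)] in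
  Config q (fun i => tape_act (act i) (ctapes c i)).

(* Tape 0 holds the input, tape 1 receives the output. *)
Definition TM_init (M : TM) (w : seq bool) : config M :=
  Config (start M) (fun i => if i == 0 :> nat then word_tape w else blank_tape).

Definition TM_outputs_within (M : TM) (w v : seq bool) (t : nat) : Prop :=
  let c := iter t (@TM_step M) (TM_init M w) in
  halting (cstate c) /\ tape_word (ctapes c (inord 1)) = v.

Definition poly_time_computable (X Y : Type) (encX : X -> seq bool)
    (encY : Y -> seq bool) (f : X -> Y) : Prop :=
  exists (M : TM) (c d : nat), forall x : X,
    TM_outputs_within M (encX x) (encY (f x)) (c * size (encX x) ^ d + c).

Record graph := Graph { order : nat; graph_of :> sgraph 'I_order }.

(* The number of vertices in unary, then the adjacency matrix row by row. *)
Definition enc_graph (G : graph) : seq bool :=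
  nseq (order G) true ++ false ::
  [seq G u v | u <- enum 'I_(order G), v <- enum 'I_(order G)].

(* The numbers of equations and of variables in unary, then, equation by
   equation, the coefficients followed by the right-hand side. *)
Definition enc_z2system (S : z2system) : seq bool :=
  nseq (neqs S) true ++ false :: nseq (nvars S) true ++ false ::
  flatten [seq rcons [seq lhs S i j == 1%R | j <- enum 'I_(nvars S)]
                     (rhs S i ord0 == 1%R) | i <- enum 'I_(neqs S)].

(* Main.v *)
From Stdlib Require Import Classical FunctionalExtensionality.
From mathcomp Require Import all_boot all_order all_algebra.
From mathcomp Require Import perm zify.
Require Import Defs.

(* Take an unknown X_uv in Z_2 for every ordered pair of vertices, with X_uv = 1
   meaning "red". On each isomorphism type of uncoloured three-vertex graph, the
   colourings allowed by F form an affine subspace: a triangle must have an even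
   number of red edges (or an odd one, in the second case), the edges of an induced
   P_3 must be equal (or different) and possibly of a fixed colour, and so on. Hence
   F-freeness is a system of equations of a bounded number of shapes, one instance
   for each triple of vertices, together with X_uv = X_vu.
   The system is written out by a program consisting of nested loops over the
   vertices, equality tests and adjacency tests. Such a program runs in polynomial
   time on a multi-tape Turing machine on which each loop variable is the position
   of a head on a tape 1^n. *)

Set Implicit Arguments.
Unset Strict Implicit.
Unset Printing Implicit Defensive.

(** * Machine fragments *)

(* Position 0 is the blank cell to the left of the word [w]. *)
Definition cell (w : seq bool) (p : nat) : sym := nth None (None :: map Some w) p.

Definition atape : Type := (seq bool * nat)%type.

(** Nothing is required of the cells to the left of position 0, which is why [GoL] is only valid
    from a positive position. *)
Definition represents (T : tape) (t : atape) : Prop :=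
  [/\ thead T = cell t.1 t.2,
      forall i, nth None (tright T) i = cell t.1 (t.2 + i).+1 &
      forall i, i < t.2 -> nth None (tleft T) i = cell t.1 (t.2 - i.+1)].

(* [Put b] appends [b] to the word, so tapes are append-only. *)
Inductive op := GoL | GoR | Keep | Put of bool.

Definition op_valid (o : op) (t : atape) : bool :=
  match o with
  | GoL => 0 < t.2
  | Put _ => t.2 == (size t.1).+1
  | _ => true
  end.

Definition op_apply (o : op) (t : atape) : atape :=
  match o with
  | GoL => (t.1, t.2.-1)
  | GoR => (t.1, t.2.+1)
  | Keep => t
  | Put b => (rcons t.1 b, t.2.+1)
  end.

Definition op_action (o : op) (h : sym) : sym * move :=
  match o with
  | GoL => (h, MoveL)
  | GoR => (h, MoveR)
  | Keep => (h, Stay)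
  | Put b => (Some b, MoveR)
  end.

Lemma cell_rcons w b p :
  cell (rcons w b) p = if p == (size w).+1 then Some b else cell w p.
Proof.
case: p => [|p] //; rewrite /cell /= eqSS map_rcons nth_rcons size_map.
by case: ltngtP => // lt_wp; rewrite nth_default // size_map ltnW.
Qed.

Lemma cell_default w p : size w < p -> cell w p = None.
Proof. by case: p => // p lt_wp; rewrite /cell nth_default //= size_map. Qed.

Lemma cell_nth w p : p < size w -> cell w p.+1 = Some (nth false w p).
Proof. by move=> lt_pw; rewrite /cell /= (nth_map false). Qed.

Lemma cell_nseq n b p : cell (nseq n b) p = if 0 < p <= n then Some b else None.
Proof.
case: p => [|p] //=; case: ltnP => hp; last by rewrite cell_default // size_nseq.
by rewrite cell_nth ?size_nseq // nth_nseq hp.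
Qed.

Lemma represents_word w : represents (word_tape w) (w, 1).
Proof.
split=> [|i|[|i]] //=.
by rewrite nth_behead add1n.
Qed.

Lemma represents_op o T t : op_valid o t -> represents T t ->
  represents (tape_act (op_action o (thead T)) T) (op_apply o t).
Proof.
case: T => l h r; case: t => w p /= ov [/= -> Hr Hl].
case: o ov => [|||b] /= ov; split=> //=.
- by rewrite -nth0 Hl // subn1.
- by case=> [|i] /=; [rewrite addn0 prednK | rewrite Hr; congr cell; lia].
- move=> i lt_ip; rewrite nth_behead Hl; last by lia.
  by congr cell; lia.
- by rewrite -nth0 Hr addn0.
- by move=> i; rewrite nth_behead Hr; congr cell; lia.
- by case=> [_|i lt_ip] /=; [rewrite subn1 | rewrite Hl //; congr cell; lia].
- by rewrite -nth0 Hr addn0 cell_rcons ifF //; apply/eqP; lia.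
- move=> i; rewrite nth_behead Hr cell_rcons ifF; last by apply/eqP; lia.
  by congr cell; lia.
- case=> [_|i lt_ip] /=; first by rewrite subn1 /= cell_rcons ov.
  rewrite Hl // cell_rcons ifF; last by apply/eqP; lia.
  by congr cell; lia.
Qed.

Lemma represents_output T w : represents T (w, 1) -> tape_word T = w.
Proof.
case: T => l h r [/= -> Hr _]; rewrite /tape_word /=.
elim: w r {l h} Hr => [|b w IHw] r Hr; first by [].
rewrite /= /cell /=; congr cons.
case: r Hr => [|x r] Hr.
  by have := Hr 0; case: w {IHw Hr}.
have := Hr 0; rewrite /cell /= => ->.
by apply: (IHw r) => i; have := Hr i.+1; rewrite /cell /= !add1n.
Qed.

Definition store := nat -> atape.

(** Stores are indexed by [nat] to keep ordinals out of the programs; only the first ten entries are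
    tapes, and the others read as blank, in agreement with [TM_trans]. *)
Definition heads (s : store) (i : nat) : sym :=
  if i < 10 then cell (s i).1 (s i).2 else None.

Definition acts_valid (a : nat -> op) (s : store) : Prop :=
  forall i, i < 10 -> op_valid (a i) (s i).

Definition acts_apply (a : nat -> op) (s : store) : store :=
  fun i => op_apply (a i) (s i).

(* Machine fragments with one entry; the successor state [None] is the exit. *)
Record frag := Frag {
  fstate : finType;
  fstart : fstate;
  ftrans : fstate -> (nat -> sym) -> option fstate * (nat -> op)
}.

Inductive frun (P : frag) : fstate P -> store -> store -> nat -> Prop :=
| frun_exit q s a : ftrans q (heads s) = (None, a) -> acts_valid a s ->
    frun q s (acts_apply a s) 1
| frun_step q q' s a s' t : ftrans q (heads s) = (Some q', a) ->
    acts_valid a s -> frun q' (acts_apply a s) s' t -> frun q s s' t.+1.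

(** The time is only an upper bound, so that branches of different lengths can share one
    estimate. *)
Definition runs (P : frag) (s s' : store) (t : nat) : Prop :=
  exists2 t', t' <= t & frun (fstart P) s s' t'.

Definition TM_trans (P : frag) (q : option (fstate P))
    (h : {ffun 'I_10 -> sym}) : option (fstate P) * ('I_10 -> sym * move) :=
  if q is Some q then
    let: (q', a) := ftrans q (fun i => oapp h None (insub i)) in
    (q', fun i : 'I_10 => op_action (a i) (h i))
  else (None, fun i => (h i, Stay)).

Definition TM_of (P : frag) : TM :=
  @MkTM 8 (option (fstate P)) (Some (fstart P)) (fun q => ~~ isSome q)
    (@TM_trans P).

Definition represents_all (T : 'I_10 -> tape) (s : store) : Prop :=
  forall i : 'I_10, represents (T i) (s i).

Lemma TM_step_frag (P : frag) (q : fstate P) q' a s (T : 'I_10 -> tape) :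
  represents_all T s -> ftrans q (heads s) = (q', a) -> acts_valid a s ->
  exists2 T', represents_all T' (acts_apply a s) &
    @TM_step (TM_of P) (@Config (TM_of P) (Some q) T) = @Config (TM_of P) q' T'.
Proof.
move=> rT tq va; pose h : {ffun 'I_10 -> sym} := [ffun i => thead (T i)].
exists (fun i : 'I_10 => tape_act (op_action (a i) (h i)) (T i)).
  by move=> i; rewrite ffunE; apply: represents_op; [apply: va | apply: rT].
rewrite /TM_step /= -/h.
have -> : (fun i => oapp h None (insub i)) = heads s.
  apply: functional_extensionality => i; rewrite /heads.
  case: insubP => [j lt_i10 <-|/negbTE ->] //=.
  by rewrite ltn_ord ffunE; case: (rT j).
by rewrite tq.
Qed.

Lemma frun_TM (P : frag) (q : fstate P) s s' t : frun q s s' t ->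
  forall T : 'I_10 -> tape, represents_all T s ->
  exists2 T', represents_all T' s' &
    iter t (@TM_step (TM_of P)) (@Config (TM_of P) (Some q) T) =
      @Config (TM_of P) None T'.
Proof.
elim=> {q s s' t} [q s a tq va|q q' s a s' t tq va _ IH] T rT.
  by have [T' rT' sT] := TM_step_frag rT tq va; exists T'.
have [T' rT' sT] := TM_step_frag rT tq va.
by have [T'' rT'' sT'] := IH _ rT'; exists T''; rewrite // iterSr sT.
Qed.

Lemma iter_TM_halted (P : frag) T t :
  iter t (@TM_step (TM_of P)) (@Config (TM_of P) None T) =
    @Config (TM_of P) None T.
Proof. by elim: t => // t /= ->. Qed.

Definition store_init (w : seq bool) : store :=
  fun i => (if i == 0 then w else [::], 1).

(** The output is read from the head onwards, so this head must be back at position 1. A halted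
    machine no longer moves, which turns the bound [t] into a statement about exactly [t] steps. *)
Lemma runs_TM_outputs (P : frag) w v s t :
  runs P (store_init w) s t -> s 1 = (v, 1) -> TM_outputs_within (TM_of P) w v t.
Proof.
case=> t' le_t't run s1.
have [|T rT eT] := @frun_TM _ _ _ _ _ run
    (fun i => if i == 0 :> nat then word_tape w else blank_tape).
  move=> i; rewrite /store_init; case: (_ == 0); first exact: represents_word.
  exact: (represents_word [::]).
rewrite /TM_outputs_within /TM_init -(subnK le_t't) iterD eT iter_TM_halted /=.
split=> //; apply: represents_output; rewrite -s1.
by have := rT (inord 1); rewrite inordK.
Qed.

(** * Sequencing, looping and branching of fragments *)

Definition act (a : (nat -> sym) -> nat -> op) : frag :=
  @Frag unit tt (fun _ h => (None, a h)).

Definition fseq (P Q : frag) : frag :=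
  @Frag (fstate P + fstate Q)%type (inl (fstart P)) (fun q h =>
    match q with
    | inl p => let: (p', a) := ftrans p h in
               (Some (if p' is Some p' then inl p' else inr (fstart Q)), a)
    | inr q => let: (q', a) := ftrans q h in (omap inr q', a)
    end).

Definition fwhile (c : (nat -> sym) -> bool) (P : frag) : frag :=
  @Frag (option (fstate P)) None (fun q h =>
    if q is Some p then let: (p', a) := ftrans p h in (Some p', a)
    else (if c h then Some (Some (fstart P)) else None, fun=> Keep)).

Definition fif (c : (nat -> sym) -> bool) (P Q : frag) : frag :=
  @Frag (option (fstate P + fstate Q))%type None (fun q h =>
    match q with
    | None => (Some (Some (if c h then inl (fstart P) else inr (fstart Q))),
               fun=> Keep)
    | Some (inl p) => let: (p', a) := ftrans p h in (omap (Some \o inl) p', a)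
    | Some (inr q) => let: (q', a) := ftrans q h in (omap (Some \o inr) q', a)
    end).

Lemma runs_le P s s' t t' : runs P s s' t -> t <= t' -> runs P s s' t'.
Proof. by case=> t0 le_t run le_tt; exists t0 => //; apply: leq_trans le_tt. Qed.

Lemma runs_act a s s' : acts_valid (a (heads s)) s ->
  acts_apply (a (heads s)) s =1 s' -> runs (act a) s s' 1.
Proof.
move=> va /functional_extensionality <-; exists 1 => //.
exact: (@frun_exit (act a) tt s).
Qed.

(** Every combinator contains copies of its parts, so one simulation serves them all: [k] is the
    state of [Q] to which the exit of [P] is redirected, and [None] means that [Q] exits too. *)
Lemma frun_embed (P Q : frag) (g : fstate P -> fstate Q) (k : option (fstate Q))
    (p : fstate P) s s' t :
  (forall p h, ftrans (g p) h =
     (if (ftrans p h).1 is Some p' then Some (g p') else k, (ftrans p h).2)) ->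
  frun p s s' t ->
  if k is Some q then forall s'' t', frun q s' s'' t' -> frun (g p) s s'' (t + t')
  else frun (g p) s s' t.
Proof.
move=> gE; elim=> {p s s' t} [p s a tp va|p p' s a s' t tp va _].
  case: k gE => [q|] gE; last by apply: frun_exit; rewrite // gE tp.
  by move=> s'' t' rq; apply: frun_step va rq; rewrite gE tp.
case: k gE => [q|] gE IH; last by apply: frun_step va IH; rewrite gE tp.
move=> s'' t' rq; rewrite addSn; apply: frun_step va (IH _ _ rq).
by rewrite gE tp.
Qed.

Lemma runs_seq P Q s1 s2 s3 t1 t2 :
  runs P s1 s2 t1 -> runs Q s2 s3 t2 -> runs (fseq P Q) s1 s3 (t1 + t2).
Proof.
case=> t1' le1 r1 [t2' le2 r2]; exists (t1' + t2'); first exact: leq_add.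
have rQ : @frun (fseq P Q) (inr (fstart Q)) s2 s3 t2'.
  apply: (@frun_embed _ (fseq P Q) inr None) r2 => q h /=.
  by case: (ftrans q h) => [[]].
apply: (@frun_embed _ (fseq P Q) inl (Some (inr (fstart Q)))) r1 _ _ rQ => p h /=.
by case: (ftrans p h) => [[]].
Qed.

Lemma runs_if c P Q s s' t : runs (if c (heads s) then P else Q) s s' t ->
  runs (fif c P Q) s s' t.+1.
Proof.
case=> t' le_t r; exists t'.+1 => //.
case: (boolP (c _)) r => cs r.
  apply: (@frun_step (fif c P Q) _ (Some (inl (fstart P))) _ (fun=> Keep)) => //=.
    by rewrite cs.
  apply: (@frun_embed _ (fif c P Q) (Some \o inl) None) r => q h /=.
  by case: (ftrans q h) => [[]].
apply: (@frun_step (fif c P Q) _ (Some (inr (fstart Q))) _ (fun=> Keep)) => //=.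
  by rewrite (negbTE cs).
apply: (@frun_embed _ (fif c P Q) (Some \o inr) None) r => q h /=.
by case: (ftrans q h) => [[]].
Qed.

(** Each of the [m] rounds costs one step for the test and at most [t] for the body; the last,
    failing test costs one more. *)
Lemma runs_while (c : (nat -> sym) -> bool) P (S : nat -> store) m t :
  (forall i, i < m -> c (heads (S i)) /\ runs P (S i) (S i.+1) t) ->
  c (heads (S m)) = false -> runs (fwhile c P) (S 0) (S m) (m * t.+1).+1.
Proof.
elim: m S => [|m IHm] S Hi Hm.
  exists 1 => //; apply: (@frun_exit (fwhile c P) None (S 0) (fun=> Keep)) => //=.
  by rewrite Hm.
have [c0 [t0 le_t0 r0]] := Hi 0 isT.
have [|t' le_t' r'] := IHm (fun i => S i.+1) _ Hm.
  by move=> i lt_im; apply: Hi.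
exists (t0 + t').+1; first by rewrite mulSn; lia.
apply: (@frun_step (fwhile c P) _ (Some (fstart P)) _ (fun=> Keep)) => //=.
  by rewrite c0.
apply: (@frun_embed _ (fwhile c P) Some (Some None)) r0 _ _ r' => p h /=.
by case: (ftrans p h) => [[]].
Qed.

(** * A language of bounded loops *)

Inductive cmd :=
| Skip
| Emit of bool
| Then of cmd & cmd
| For of nat & cmd
| IfEq of nat & nat & cmd & cmd
| IfAdj of nat & nat & cmd & cmd.

Definition upd (e : nat -> nat) (x i : nat) : nat -> nat :=
  fun y => if y == x then i else e y.

(* The value [i] of a loop variable, [0 <= i < n], is stored as [i.+1], the
   position of the head on its tape; [0] marks an inactive variable. *)
Fixpoint eval (n : nat) (adj : nat -> nat -> bool) (c : cmd) (e : nat -> nat)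
    : seq bool :=
  match c with
  | Skip => [::]
  | Emit b => [:: b]
  | Then c d => eval n adj c e ++ eval n adj d e
  | For x c => flatten [seq eval n adj c (upd e x i.+1) | i <- iota 0 n]
  | IfEq x y c d => if e x == e y then eval n adj c e else eval n adj d e
  | IfAdj x y c d =>
      if adj (e x).-1 (e y).-1 then eval n adj c e else eval n adj d e
  end.

(** Five tapes hold loop variables, hence [x < 5]. In [IfEq] the variables must differ because the
    test moves both heads at once. *)
Fixpoint wf (bnd : seq nat) (c : cmd) : bool :=
  match c with
  | Skip | Emit _ => true
  | Then c d => wf bnd c && wf bnd d
  | For x c => [&& x < 5, x \notin bnd & wf (x :: bnd) c]
  | IfEq x y c d =>
      [&& x \in bnd, y \in bnd, x != y, wf bnd c & wf bnd d]
  | IfAdj x y c d => [&& x \in bnd, y \in bnd, wf bnd c & wf bnd d]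
  end.

Fixpoint moves (l : seq (nat * op)) (i : nat) : op :=
  if l is (j, o) :: l then if i == j then o else moves l i else Keep.

Definition mv (l : seq (nat * op)) : frag := act (fun=> moves l).

Definition on (i : nat) (h : nat -> sym) : bool := isSome (h i).

(** One walk along tape 4, whose word has length [n], carries the matrix head [n] cells further,
    that is, by one row; the head of tape 4 then returns to the blank at position 0. *)
Definition next_row : frag :=
  fseq (mv [:: (4, GoR)])
  (fseq (fwhile (on 4) (mv [:: (2, GoR); (4, GoR)]))
  (fseq (mv [:: (4, GoL)]) (fwhile (on 4) (mv [:: (4, GoL)])))).

(* Repeats [P] as often as the value of [x]; tape 3 serves to restore [x]. *)
Definition repeat_val (x : nat) (P : frag) : frag :=
  fseq (mv [:: (x.+4.+1, GoL)])
  (fseq (fwhile (on x.+4.+1) (fseq (mv [:: (x.+4.+1, GoL); (3, GoR)]) P))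
  (fseq (mv [:: (x.+4.+1, GoR)]) (fwhile (on 3) (mv [:: (x.+4.+1, GoR); (3, GoL)])))).

Definition rewind (i : nat) : frag :=
  fseq (fwhile (on i) (mv [:: (i, GoL)])) (mv [:: (i, GoR)]).

(* Both loop variables have been decreased until one reached 0; tape 3 holds the
   number of steps to undo. *)
Definition eq_restore (x y : nat) : frag :=
  fwhile (on 3) (mv [:: (x.+4.+1, GoR); (y.+4.+1, GoR); (3, GoL)]).

Fixpoint compile (c : cmd) : frag :=
  match c with
  | Skip => mv [::]
  | Emit b => mv [:: (1, Put b)]
  | Then c d => fseq (compile c) (compile d)
  | For x c =>
      fseq (mv [:: (x.+4.+1, GoR)])
      (fseq (fwhile (on x.+4.+1) (fseq (compile c) (mv [:: (x.+4.+1, GoR)])))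
      (fseq (mv [:: (x.+4.+1, GoL)]) (fwhile (on x.+4.+1) (mv [:: (x.+4.+1, GoL)]))))
  | IfEq x y c d =>
      fseq (fwhile (fun h => on x.+4.+1 h && on y.+4.+1 h)
                   (mv [:: (x.+4.+1, GoL); (y.+4.+1, GoL); (3, GoR)]))
      (fif (fun h => ~~ on x.+4.+1 h && ~~ on y.+4.+1 h)
           (fseq (eq_restore x y) (compile c)) (fseq (eq_restore x y) (compile d)))
  | IfAdj x y c d =>
      (* For vertices [i] and [j] the matrix head advances by [i * n + j] cells, the place of this
         entry in the row-by-row listing. *)
      fseq (fseq (repeat_val x next_row) (repeat_val y (mv [:: (2, GoR)])))
      (fif (fun h => h 2 == Some true)
           (fseq (rewind 2) (compile c)) (fseq (rewind 2) (compile d)))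
  end.

(** The costs of both branches are added instead of taking their maximum, which keeps the bound a
    polynomial expression in [n]. *)
Fixpoint cost (n : nat) (c : cmd) : nat :=
  match c with
  | Skip | Emit _ => 1
  | Then c d => cost n c + cost n d
  | For _ c => n * (cost n c + 4) + 4
  | IfEq _ _ c d => n * 4 + 3 + cost n c + cost n d
  | IfAdj _ _ c d => n * (4 * n + 8) + n * 5 + n * n * 2 + 11 + cost n c + cost n d
  end.

Definition poly_bounded (f : nat -> nat) : Prop :=
  exists a d, forall n, f n <= a * n.+1 ^ d.

Lemma poly_boundedD f g :
  poly_bounded f -> poly_bounded g -> poly_bounded (fun n => f n + g n).
Proof.
case=> [a [d fa]] [b [d' gb]]; exists (a + b), (d + d') => n.
have h1 : n.+1 ^ d <= n.+1 ^ (d + d') by rewrite leq_pexp2l // leq_addr.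
have h2 : n.+1 ^ d' <= n.+1 ^ (d + d') by rewrite leq_pexp2l // leq_addl.
have := fa n; have := gb n; nia.
Qed.

Lemma poly_boundedM f g :
  poly_bounded f -> poly_bounded g -> poly_bounded (fun n => f n * g n).
Proof.
case=> [a [d fa]] [b [d' gb]]; exists (a * b), (d + d') => n.
by rewrite expnD mulnACA leq_mul.
Qed.

Lemma poly_bounded_cst a : poly_bounded (fun=> a).
Proof. by exists a, 0 => n; rewrite muln1. Qed.

Lemma poly_bounded_id : poly_bounded id.
Proof. by exists 1, 1 => n; rewrite mul1n expn1. Qed.

Lemma poly_bounded_cost c : poly_bounded (cost^~ c).
Proof.
elim: c => [|b|c IHc d IHd|x c IHc|x y c IHc d IHd|x y c IHc d IHd] /=;
  repeat first [exact: IHc | exact: IHd | exact: poly_bounded_cst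
    | exact: poly_bounded_id | apply: poly_boundedD | apply: poly_boundedM].
Qed.

(** * Correctness and running time of compiled programs *)

Section Compile.

Context (n : nat) (inp mat : seq bool) (adj : nat -> nat -> bool).
Context (size_mat : size mat = n * n).
Context (nth_mat : forall i j, i < n -> j < n ->
  nth false mat (i * n + j) = adj i j).

(* Tapes: 0 input, 1 output, 2 adjacency matrix, 3 and 4 scratch counters, from 5
   on the loop variables. A counter is the position of the head on a tape 1^n. *)
Definition St (m z b : nat) (e : nat -> nat) (out : seq bool) : store :=
  fun i => match i with
  | 0 => (inp, (size inp).+1)
  | 1 => (out, (size out).+1)
  | 2 => (mat, m)
  | 3 => (nseq n true, z)
  | 4 => (nseq n true, b)
  | i.+4.+1 => (nseq n true, e i)
  end.

Lemma on_var x m z b e out : x < 5 ->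
  on x.+4.+1 (heads (St m z b e out)) = (0 < e x <= n).
Proof. by move=> lt_x5; rewrite /on /heads !ltnS -ltnS lt_x5 /= cell_nseq; case: ifP. Qed.

Lemma on3 m z b e out : on 3 (heads (St m z b e out)) = (0 < z <= n).
Proof. by rewrite /on /heads /= cell_nseq; case: ifP. Qed.

Lemma on4 m z b e out : on 4 (heads (St m z b e out)) = (0 < b <= n).
Proof. by rewrite /on /heads /= cell_nseq; case: ifP. Qed.

Lemma upd_same e x i : upd e x i x = i.
Proof. by rewrite /upd eqxx. Qed.

Lemma upd_id e x : upd e x (e x) = e.
Proof. by apply: functional_extensionality => y; rewrite /upd; case: eqP => [->|]. Qed.

Lemma runs_mv l s s' : acts_valid (moves l) s -> acts_apply (moves l) s =1 s' ->
  runs (mv l) s s' 1.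
Proof. exact: runs_act. Qed.

Lemma runs_loop (S : nat -> store) k t (c : (nat -> sym) -> bool) P s s' T :
  s = S 0 -> S k = s' -> (k * t.+1).+1 <= T -> (forall i, i < k -> c (heads (S i)) /\ runs P (S i) (S i.+1) t) ->
  c (heads (S k)) = false -> runs (fwhile c P) s s' T.
Proof. by move=> -> <- leT Hi Hk; apply: runs_le leT; apply: runs_while. Qed.

Lemma runs_next_row m z e out :
  runs next_row (St m z 0 e out) (St (m + n) z 0 e out) (4 * n + 4).
Proof.
apply: (@runs_le _ _ _ (1 + ((n * 2).+1 + (1 + (n * 2).+1)))); last by lia.
apply: runs_seq.
  by apply: (@runs_mv _ _ (St (m + 0) z 1 e out)) => -[|[|[|[|[|i]]]]] //=; rewrite addn0.
apply: runs_seq.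
  apply: (@runs_loop (fun i => St (m + i) z i.+1 e out) n 1) => // [i lt_in|].
    rewrite on4; split; first by lia.
    by apply: runs_mv => -[|[|[|[|[|j]]]]] //=; rewrite addnS.
  by rewrite on4; lia.
apply: runs_seq.
  by apply: (@runs_mv _ _ (St (m + n) z n e out)) => -[|[|[|[|[|j]]]]] //=; rewrite subn0.
apply: (@runs_loop (fun i => St (m + n) z (n - i) e out) n 1) => // [||i lt_in|].
- by rewrite subn0.
- by rewrite subnn.
- rewrite on4; split; first by lia.
  apply: runs_mv => -[|[|[|[|[|j]]]]] //=; first by rewrite subn_gt0.
  by rewrite subnS.
- by rewrite on4; lia.
Qed.

(** The body is executed [(e x).-1] times, as a value [i] is stored as [i.+1]. The hypothesis on [P]
    ranges over all positions on tape 3 and all environments, because inside the loop tape 3 counts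
    the rounds and [x] is partly counted down. *)
Lemma runs_repeat_val x P d t m e out : x < 5 -> 0 < e x <= n ->
  (forall m z e out, runs P (St m z 0 e out) (St (m + d) z 0 e out) t) ->
  runs (repeat_val x P) (St m 0 0 e out) (St (m + (e x).-1 * d) 0 0 e out)
    (n * (t + 4) + 4).
Proof.
move=> lt_x5 ex rP; set k := (e x).-1.
have lt_kn : k < n by rewrite /k; lia.
have exE : e x = k.+1 by rewrite /k; lia.
apply: (@runs_le _ _ _ (1 + ((k * t.+2).+1 + (1 + (k * 2).+1)))); last by nia.
apply: runs_seq.
  apply: (@runs_mv _ _ (St m 0 0 (upd e x k) out)) => -[|[|[|[|[|j]]]]] //=.
    by rewrite !eqSS; case: (j =P x) => [E|_]; rewrite ?E //=; lia.
  by rewrite /acts_apply /= !eqSS /upd; case: (j =P x) => [E|_]; rewrite ?E.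
apply: runs_seq.
  apply: (@runs_loop (fun i => St (m + i * d) i 0 (upd e x (k - i)) out) k t.+1)
    => // [|i lt_ik|].
  - by rewrite mul0n addn0 subn0.
  - rewrite on_var // upd_same; split; first by lia.
    rewrite -(add1n t); apply: runs_seq; last first.
      by rewrite mulSnr addnA; apply: rP.
    apply: runs_mv => -[|[|[|[|[|j]]]]] //=.
      by rewrite !eqSS; case: (j =P x) => [E|_]; rewrite ?E //=; rewrite upd_same; lia.
    by rewrite /acts_apply /= !eqSS /upd; case: (j =P x) => [E|_]; rewrite ?E //=; rewrite subnS.
  - by rewrite on_var // upd_same subnn.
apply: runs_seq.
  apply: (@runs_mv _ _ (St (m + k * d) (k - 0) 0 (upd e x 1) out)) => -[|[|[|[|[|j]]]]] //=.
  - by rewrite !eqSS; case: eqP.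
  - by rewrite /acts_apply /= subn0.
  - by rewrite /acts_apply /= !eqSS /upd; case: (j =P x) => [E|_]; rewrite ?E //=; rewrite subnn.
apply: (@runs_loop (fun i => St (m + k * d) (k - i) 0 (upd e x i.+1) out) k 1)
    => // [|i lt_ik|].
- by rewrite subnn -exE upd_id.
- rewrite on3; split; first by lia.
  apply: runs_mv => -[|[|[|[|[|j]]]]] //=.
  + by rewrite subn_gt0.
  + by rewrite !eqSS; case: eqP.
  + by rewrite /acts_apply /= subnS.
  + by rewrite /acts_apply /= !eqSS /upd; case: (j =P x) => [E|_]; rewrite ?E.
- by rewrite on3 subnn.
Qed.

(** The cells from position [m] down to 1 are all non-blank, so the first blank met by the loop is
    position 0. *)
Lemma runs_rewind_mat m e out : 0 < m <= n * n ->
  runs (rewind 2) (St m 0 0 e out) (St 1 0 0 e out) (m * 2 + 2).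
Proof.
move=> hm; apply: (@runs_le _ _ _ ((m * 2).+1 + 1)); last by lia.
apply: (@runs_seq _ _ _ (St 0 0 0 e out)).
  apply: (@runs_loop (fun i => St (m - i) 0 0 e out) m 1) => // [||i lt_im|].
  - by rewrite subn0.
  - by rewrite subnn.
  - split.
      rewrite /on /heads /=; case E: (m - i) => [|p]; first by lia.
      by rewrite cell_nth // size_mat; lia.
    apply: runs_mv => -[|[|[|[|[|j]]]]] //=; first by rewrite subn_gt0.
    by rewrite /acts_apply /= subnS.
  - by rewrite /on /heads /= subnn.
by apply: runs_mv => -[|[|[|[|[|j]]]]].
Qed.

Lemma runs_eq_restore x y k e out : x != y -> x < 5 -> y < 5 -> k <= n ->
  k <= e x -> k <= e y ->
  runs (eq_restore x y) (St 1 k 0 (upd (upd e x (e x - k)) y (e y - k)) out)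
    (St 1 0 0 e out) (n * 2 + 1).
Proof.
move=> neq_xy lt_x5 lt_y5 le_kn le_kx le_ky.
apply: (@runs_loop (fun i => St 1 (k - i) 0
    (upd (upd e x (e x - (k - i))) y (e y - (k - i))) out) k 1) => // [|||i lt_ik|].
- by rewrite subn0.
- by rewrite subnn !subn0 !upd_id.
- by lia.
- rewrite on3; split; first by lia.
  apply: runs_mv => -[|[|[|[|[|j]]]]] //=.
  + by rewrite subn_gt0.
  + by rewrite !eqSS; case: eqP => //; case: eqP.
  + by rewrite /acts_apply /= subnS.
  + rewrite /acts_apply /= !eqSS /upd.
    case: (j =P x) => [E|_]; rewrite ?E; first by rewrite (negbTE neq_xy) /=; congr pair; lia.
    by case: (j =P y) => [E|_]; rewrite ?E //=; congr pair; lia.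
- by rewrite on3 subnn.
Qed.

(** An inactive variable rests at position 0, so that a loop is entered by a single move to the
    right. *)
Definition env_inv (bnd : seq nat) (e : nat -> nat) : Prop :=
  forall x, if x \in bnd then (x < 5) && (0 < e x <= n) else e x == 0.

(** Every program brings the matrix, scratch and loop heads back to where they were and only appends
    to the output; this rest configuration is what lets subprograms be composed. *)
Lemma runs_compile c bnd e out : wf bnd c -> env_inv bnd e ->
  runs (compile c) (St 1 0 0 e out) (St 1 0 0 e (out ++ eval n adj c e)) (cost n c).
Proof.
elim: c bnd e out => [|b|c IHc d IHd|x c IHc|x y c IHc d IHd|x y c IHc d IHd]
  bnd e out /=.
- by move=> _ _; rewrite cats0; apply: runs_mv.
- by move=> _ _; rewrite cats1; apply: runs_mv => -[|[|[|[|[|j]]]]] //=;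
    rewrite /acts_apply /= size_rcons.
- by move=> /andP[wc wd] he; rewrite catA; apply: runs_seq; [apply: IHc he | apply: IHd he].
- case/and3P=> lt_x5 x_bnd wc he.
  have ex0 : e x = 0 by apply/eqP; have := he x; rewrite (negbTE x_bnd).
  apply: (@runs_le _ _ _ (1 + ((n * (cost n c + 1).+1).+1 + (1 + (n * 2).+1)))); last by lia.
  (* [O i] is the output after [i] rounds. The loop head then stands at position [i.+1], which after
     [n] rounds is the blank beyond the word. *)
  pose O i := out ++ flatten [seq eval n adj c (upd e x j.+1) | j <- iota 0 i].
  apply: runs_seq.
    apply: (@runs_mv _ _ (St 1 0 0 (upd e x 1) (O 0))) => -[|[|[|[|[|j]]]]] //=.
    + by rewrite !eqSS; case: eqP.
    + by rewrite /acts_apply /= /O /= cats0.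
    + by rewrite /acts_apply /= !eqSS /upd; case: (j =P x) => [->|_]; rewrite ?ex0.
  apply: runs_seq.
    apply: (@runs_loop (fun i => St 1 0 0 (upd e x i.+1) (O i)) n (cost n c + 1))
      => // [i lt_in|].
    + rewrite on_var // upd_same; split; first by lia.
      apply: (@runs_seq _ _ _ (St 1 0 0 (upd e x i.+1) (O i.+1))).
        have -> : O i.+1 = O i ++ eval n adj c (upd e x i.+1).
          by rewrite /O -{1}addn1 iotaD map_cat flatten_cat /= cats0 catA.
        apply: IHc wc _ => y; rewrite inE /upd.
        by case: eqP => [->|_] /=; [rewrite lt_x5 | apply: he].
      apply: runs_mv => -[|[|[|[|[|j]]]]] //=.
        by rewrite !eqSS; case: eqP.
      by rewrite /acts_apply /= !eqSS /upd; case: (j =P x).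
    + by rewrite on_var // upd_same ltnn.
  apply: runs_seq.
    apply: (@runs_mv _ _ (St 1 0 0 (upd e x (n - 0)) (O n))) => -[|[|[|[|[|j]]]]] //=.
      by rewrite !eqSS; case: eqP => [->|] //=; rewrite upd_same.
    by rewrite /acts_apply /= !eqSS /upd; case: (j =P x) => //= _; rewrite subn0.
  apply: (@runs_loop (fun i => St 1 0 0 (upd e x (n - i)) (O n)) n 1) => // [|i lt_in|].
  + by rewrite subnn -[in upd e x _]ex0 upd_id.
  + rewrite on_var // upd_same; split; first by lia.
    apply: runs_mv => -[|[|[|[|[|j]]]]] //=.
      by rewrite !eqSS; case: eqP => [->|] //=; rewrite upd_same; lia.
    by rewrite /acts_apply /= !eqSS /upd; case: (j =P x) => //= _; rewrite subnS.
  + by rewrite on_var // upd_same subnn.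
- case/and5P=> bx by_ neq_xy wc wd he.
  have := he x; have := he y; rewrite bx by_ => /andP[lt_y5 ey] /andP[lt_x5 ex].
  (* Both heads move left together until the smaller value is used up, so afterwards both are on a
     blank exactly when the values were equal. *)
  pose k := minn (e x) (e y).
  pose E i := upd (upd e x (e x - i)) y (e y - i).
  have Ex i : E i x = e x - i by rewrite /E /upd (negbTE neq_xy) eqxx.
  have Ey i : E i y = e y - i by rewrite /E /upd eqxx.
  apply: (@runs_le _ _ _ ((n * 2).+1 + (n * 2 + 1 + (cost n c + cost n d)).+1)); last by lia.
  apply: (@runs_seq _ _ _ (St 1 k 0 (E k) out)).
    apply: (@runs_loop (fun i => St 1 i 0 (E i) out) k 1) => // [||i lt_ik|].
    + by rewrite /E !subn0 !upd_id.
    + by rewrite /k; lia.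
    + rewrite !on_var // Ex Ey; split; first by rewrite /k in lt_ik; lia.
      apply: runs_mv => -[|[|[|[|[|j]]]]] //=.
        rewrite !eqSS; case: (j =P x) => [->|_] /=; first by rewrite Ex /k in lt_ik *; lia.
        by case: (j =P y) => [->|_] //=; rewrite Ey /k in lt_ik *; lia.
      rewrite /acts_apply /= !eqSS; case: (j =P x) => [->|/eqP jx] /=.
        by rewrite !Ex subnS.
      case: (j =P y) => [->|/eqP jy] /=; first by rewrite !Ey subnS.
      by rewrite /E /upd (negbTE jx) (negbTE jy).
    + by rewrite !on_var // Ex Ey /k; lia.
  apply: runs_if; rewrite !on_var // Ex Ey.
  have -> : (~~ (0 < e x - k <= n) && ~~ (0 < e y - k <= n)) = (e x == e y).
    by rewrite /k; lia.
  have rE : runs (eq_restore x y) (St 1 k 0 (E k) out) (St 1 0 0 e out) (n * 2 + 1).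
    by apply: runs_eq_restore; rewrite // /k; lia.
  case: ifP => _; apply: runs_seq rE _.
    by apply: runs_le (IHc _ _ _ wc he) _; apply: leq_addr.
  by apply: runs_le (IHd _ _ _ wd he) _; apply: leq_addl.
- case/and4P=> bx by_ wc wd he.
  have := he x; have := he y; rewrite bx by_ => /andP[lt_y5 ey] /andP[lt_x5 ex].
  pose m := (e x).-1 * n + (e y).-1.
  have lt_m : m < n * n by rewrite /m; nia.
  apply: (@runs_le _ _ _ ((n * (4 * n + 4 + 4) + 4 + (n * (1 + 4) + 4)) +
      (n * n * 2 + 2 + (cost n c + cost n d)).+1)); last by lia.
  (* The matrix head starts at position 1, hence entry [m] is read at position [m.+1]. *)
  apply: (@runs_seq _ _ _ (St m.+1 0 0 e out)).
    have -> : m.+1 = 1 + (e x).-1 * n + (e y).-1 * 1 by rewrite /m; lia.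
    apply: runs_seq.
      by apply: runs_repeat_val => // m' z e' out'; apply: runs_next_row.
    apply: runs_repeat_val => // m' z e' out'.
    by apply: runs_mv => -[|[|[|[|[|j]]]]] //=; rewrite addn1.
  apply: runs_if.
  have -> : (heads (St m.+1 0 0 e out) 2 == Some true) = adj (e x).-1 (e y).-1.
    rewrite /heads /= cell_nth ?size_mat // -nth_mat; [|lia|lia].
    by rewrite -/m; case: nth.
  have rR : runs (rewind 2) (St m.+1 0 0 e out) (St 1 0 0 e out) (n * n * 2 + 2).
    by apply: runs_le (runs_rewind_mat _ _ _) _; lia.
  case: ifP => _; apply: runs_seq rR _.
    by apply: runs_le (IHc _ _ _ wc he) _; apply: leq_addr.
  by apply: runs_le (IHd _ _ _ wd he) _; apply: leq_addl.
Qed.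

End Compile.

(** * Polynomial-time computability *)

Definition on_copies (o : op) (i : nat) : op := if i < 3 then Keep else o.

(** The unary prefix of the input is copied to all tapes from 3 on, the separator is skipped, the
    matrix is copied to tape 2, and the heads are moved to the rest positions that compiled programs
    start from. *)
Definition setup : frag :=
  fseq (fwhile (fun h => h 0 == Some true)
    (act (fun _ i => if i == 0 then GoR else on_copies (Put true) i)))
  (fseq (act (fun _ i => if i == 0 then GoR else on_copies GoL i))
  (fseq (fwhile (on 0)
    (act (fun h => moves [:: (0, GoR); (2, Put (h 0 == Some true))])))
  (* Appending leaves the head on the blank behind the word, where the loop of [rewind] would stop
     at once; hence the extra move to the left. *)
  (fseq (fseq (mv [:: (2, GoL)]) (rewind 2))
  (fwhile (on 3) (act (fun=> on_copies GoL)))))).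

Definition setup_store (inp : seq bool) (p : nat) (t2 t3 : atape) : store :=
  fun i => match i with
  | 0 => (inp, p)
  | 1 => ([::], 1)
  | 2 => t2
  | _ => t3
  end.

Lemma runs_setup n mat (inp := nseq n true ++ false :: mat) :
  size mat = n * n ->
  runs setup (store_init inp) (St n inp mat 1 0 0 (fun=> 0) [::])
    (4 * n + 4 * (n * n) + 7).
Proof.
move=> size_mat.
have cell_ones i : i < n -> cell inp i.+1 = Some true.
  move=> lt_in; rewrite cell_nth ?size_cat ?size_nseq; last by lia.
  by rewrite nth_cat size_nseq lt_in nth_nseq lt_in.
have cell_sep : cell inp n.+1 = Some false.
  rewrite cell_nth ?size_cat ?size_nseq /=; last by lia.
  by rewrite nth_cat size_nseq ltnn subnn.
have cell_mat i : i < n * n -> cell inp (n.+2 + i) = Some (nth false mat i).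
  move=> lt_i; rewrite addSn cell_nth ?size_cat ?size_nseq /= ?size_mat; last by lia.
  rewrite nth_cat size_nseq ifF; last by apply/negbTE; lia.
  by have -> : n.+1 + i - n = i.+1 by lia.
have cell_end : cell inp (n.+2 + n * n) = None.
  by rewrite cell_default // size_cat size_nseq /= size_mat; lia.
pose ones i : atape := (nseq i true, i.+1).
pose W := setup_store inp.
apply: (@runs_le _ _ _ ((n * 2).+1 + (1 + ((n * n * 2).+1 +
    ((1 + ((n * n * 2).+1 + 1)) + (n * 2).+1))))); last by lia.
apply: runs_seq.
  apply: (@runs_loop (fun i => W i.+1 ([::], 1) (ones i)) n 1) => // [|i lt_in|].
  - by apply: functional_extensionality => -[|[|[|j]]].
  - rewrite /heads /= cell_ones //; split=> //.
    apply: runs_act => -[|[|[|j]]] //=.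
      by rewrite /on_copies /= size_nseq.
    by rewrite /acts_apply /on_copies /= /ones -(addn1 i) nseqD cats1.
  - by rewrite /heads /= cell_sep.
apply: runs_seq.
  apply: (@runs_act _ _ (W (n.+2 + 0) (take 0 mat, 1) (nseq n true, n))) => -[|[|[|j]]] //=.
    by rewrite addn0.
  by rewrite take0.
apply: runs_seq.
  apply: (@runs_loop (fun i => W (n.+2 + i) (take i mat, i.+1) (nseq n true, n)) (n * n) 1)
    => // [i lt_i|].
  - rewrite /on /heads /= cell_mat //; split=> //.
    apply: runs_act => -[|[|[|[|j]]]] //=.
    + by rewrite size_takel // size_mat ltnW.
    + by rewrite /acts_apply /= addnS.
    + rewrite /acts_apply /= /heads /= cell_mat // (take_nth false) ?size_mat //.
      by case: nth.
  - by rewrite /on /heads /= cell_end.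
rewrite -size_mat take_size.
apply: runs_seq.
  apply: runs_seq.
    by apply: (@runs_mv _ _ (W (n.+2 + size mat) (mat, size mat - 0) (nseq n true, n)))
      => -[|[|[|[|j]]]] //=; rewrite subn0.
  apply: (@runs_seq _ _ _ (W (n.+2 + size mat) (mat, 0) (nseq n true, n))).
    apply: (@runs_loop (fun i => W (n.+2 + size mat) (mat, size mat - i) (nseq n true, n))
      (size mat) 1) => // [|i lt_i|].
    + by rewrite subnn.
    + split.
        rewrite /on /heads /=; case E: (size mat - i) => [|p]; first by lia.
        by rewrite cell_nth //; lia.
      apply: runs_mv => -[|[|[|[|j]]]] //=; first by rewrite subn_gt0.
      by rewrite /acts_apply /= subnS.
    + by rewrite /on /heads /= subnn.
  by apply: (@runs_mv _ _ (W (n.+2 + size mat) (mat, 1) (nseq n true, n)))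
    => -[|[|[|[|j]]]].
apply: (@runs_loop (fun i => W (n.+2 + size mat) (mat, 1) (nseq n true, n - i)) n 1)
  => // [||i lt_i|].
- by rewrite subn0.
- apply: functional_extensionality => -[|[|[|[|[|j]]]]] //=; rewrite ?subnn //.
  by rewrite size_cat size_nseq /=; congr pair; lia.
- rewrite /on /heads /= cell_nseq ifT; last by lia.
  split=> //; apply: runs_act => -[|[|[|j]]] //=.
    by rewrite /on_copies /= subn_gt0.
  by rewrite /acts_apply /on_copies /= subnS.
- by rewrite /on /heads /= subnn.
Qed.

(** Each letter costs a step, so the time bound also bounds the length of the output and thereby the
    time of the final rewinding of tape 1. *)
Lemma size_eval n adj c e : size (eval n adj c e) <= cost n c.
Proof.
elim: c e => [|b|c IHc d IHd|x c IHc|x y c IHc d IHd|x y c IHc d IHd] e //=.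
- by rewrite size_cat leq_add.
- apply: (@leq_trans (n * cost n c)); last by lia.
  suff H k i : size (flatten [seq eval n adj c (upd e x j.+1) | j <- iota i k])
      <= k * cost n c by apply: H.
  by elim: k i => [|k IHk] i //=; rewrite size_cat mulSn leq_add.
- by have := IHc e; have := IHd e; case: ifP => _; lia.
- by have := IHc e; have := IHd e; case: ifP => _; lia.
Qed.

Definition finish : frag := fseq (mv [:: (1, GoL)]) (rewind 1).

Lemma runs_finish n inp mat e out : exists2 s, s 1 = (out, 1) &
  runs finish (St n inp mat 1 0 0 e out) s (2 * size out + 3).
Proof.
pose Q k : store := fun i => if i == 1 then (out, k) else St n inp mat 1 0 0 e out i.
exists (Q 1) => //.
apply: (@runs_le _ _ _ (1 + ((size out * 2).+1 + 1))); last by lia.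
apply: runs_seq.
  by apply: (@runs_mv _ _ (Q (size out - 0))) => -[|[|j]] //; rewrite subn0.
apply: (@runs_seq _ _ _ (Q 0)).
  apply: (@runs_loop (fun i => Q (size out - i)) (size out) 1) => // [|i lt_i|].
  - by rewrite subnn.
  - split.
      rewrite /on /heads /=; case E: (size out - i) => [|p]; first by lia.
      by rewrite cell_nth //; lia.
    apply: runs_mv => -[|[|j]] //=; first by rewrite /Q /= subn_gt0.
    by rewrite /acts_apply /Q /= subnS.
  - by rewrite /on /heads /= subnn.
by apply: runs_mv => -[|[|j]].
Qed.

Definition adj_matrix (G : graph) : seq bool :=
  [seq G u v | u <- enum 'I_(order G), v <- enum 'I_(order G)].

Definition adj_nat (G : graph) (i j : nat) : bool :=
  nth false (adj_matrix G) (i * order G + j).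

Lemma size_adj_matrix (G : graph) : size (adj_matrix G) = order G * order G.
Proof. by rewrite size_allpairs size_enum_ord. Qed.

Lemma nth_allpairs (S T R : Type) (x0 : S) (y0 : T) (z0 : R) (f : S -> T -> R) s t i j :
  i < size s -> j < size t ->
  nth z0 [seq f x y | x <- s, y <- t] (i * size t + j) = f (nth x0 s i) (nth y0 t j).
Proof.
elim: s i => [|x s IHs] [|i] //= lt_i lt_j; rewrite nth_cat size_map.
  by rewrite mul0n add0n lt_j (nth_map y0).
by rewrite mulSn -addnA ltnNge leq_addr /= addKn IHs.
Qed.

Lemma adj_nat_ord (G : graph) (u v : 'I_(order G)) : adj_nat G u v = G u v.
Proof.
have := @nth_allpairs _ _ _ u u false (fun u v => G u v)
  (enum 'I_(order G)) (enum 'I_(order G)) u v.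
by rewrite !size_enum_ord !nth_ord_enum; apply.
Qed.

(** The time is polynomial in the number [n] of vertices, and hence in the input length, because the
    input contains [n] in unary. *)
Lemma poly_time_eval c (f : graph -> z2system) : wf [::] c ->
  (forall G, enc_z2system (f G) = eval (order G) (adj_nat G) c (fun=> 0)) ->
  poly_time_computable enc_graph enc_z2system f.
Proof.
move=> wf_c fE.
pose T n := 4 * n + 4 * (n * n) + 7 + (cost n c + (2 * cost n c + 3)).
have [a [d Ta]] : poly_bounded T.
  rewrite /T; repeat first [exact: poly_bounded_cost | exact: poly_bounded_cst
    | exact: poly_bounded_id | apply: poly_boundedD | apply: poly_boundedM].
exists (TM_of (fseq setup (fseq (compile c) finish))), a, d => G.
set n := order G; have size_mat := size_adj_matrix G.
set out := enc_z2system _.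
have [s s1 rF] := runs_finish n (enc_graph G) (adj_matrix G) (fun=> 0) out.
apply: runs_TM_outputs s1.
apply: (@runs_le _ _ _ (T n)); last first.
  apply: leq_trans (Ta n) _; apply: leq_trans (leq_addr _ _).
  rewrite leq_mul2l; apply/orP; right.
  (* The unary part and its separator already make up [n.+1] letters. Comparing the bases requires a
     positive exponent. *)
  case: (d) => // d'; rewrite leq_exp2r //.
  by rewrite /enc_graph size_cat size_nseq /=; lia.
apply: runs_seq; first exact: runs_setup.
apply: runs_seq; last first.
  by apply: runs_le rF _; rewrite leq_add2r leq_mul2l /out fE size_eval.
rewrite /out fE -[eval _ _ _ _]cat0s.
by apply: (@runs_compile _ _ _ (adj_nat G) size_mat _ c [::]) => // i j _ _.
Qed.

(** * Linear systems given by equation schemes *)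

Inductive bexp :=
| BConst of bool
| BEq of nat & nat
| BAdj of nat & nat
| BNot of bexp
| BAnd of bexp & bexp
| BXor of bexp & bexp.

Fixpoint beval (adj : nat -> nat -> bool) (b : bexp) (e : nat -> nat) : bool :=
  match b with
  | BConst b => b
  | BEq x y => e x == e y
  | BAdj x y => adj (e x).-1 (e y).-1
  | BNot b => ~~ beval adj b e
  | BAnd b b' => beval adj b e && beval adj b' e
  | BXor b b' => beval adj b e (+) beval adj b' e
  end.

Fixpoint bwf (bnd : seq nat) (b : bexp) : bool :=
  match b with
  | BConst _ => true
  | BEq x y => [&& x \in bnd, y \in bnd & x != y]
  | BAdj x y => (x \in bnd) && (y \in bnd)
  | BNot b => bwf bnd b
  | BAnd b b' | BXor b b' => bwf bnd b && bwf bnd b'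
  end.

(** Connectives are expanded into nested tests. This duplicates [c] and [d], but the expression is
    fixed and does not grow with the graph. *)
Fixpoint ifb (b : bexp) (c d : cmd) : cmd :=
  match b with
  | BConst b => if b then c else d
  | BEq x y => IfEq x y c d
  | BAdj x y => IfAdj x y c d
  | BNot b => ifb b d c
  | BAnd b b' => ifb b (ifb b' c d) d
  | BXor b b' => ifb b (ifb b' d c) (ifb b' c d)
  end.

Lemma eval_ifb n adj b c d e :
  eval n adj (ifb b c d) e = if beval adj b e then eval n adj c e else eval n adj d e.
Proof.
elim: b c d => [[]|x y|x y|b IHb|b IHb b' IHb'|b IHb b' IHb'] c d //=.
- by rewrite IHb; case: beval.
- by rewrite IHb IHb'; case: beval.
- by rewrite IHb !IHb'; do 2 case: beval.
Qed.

Lemma wf_ifb bnd b c d : bwf bnd b -> wf bnd c -> wf bnd d -> wf bnd (ifb b c d).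
Proof.
elim: b c d => [[]|x y|x y|b IHb|b IHb b' IHb'|b IHb b' IHb'] c d //=.
- by case/and3P=> -> -> -> -> ->.
- by case/andP=> -> -> -> ->.
- by move=> wb wc wd; apply: IHb.
- by case/andP=> wb wb' wc wd; apply: IHb => //; apply: IHb'.
- by case/andP=> wb wb' wc wd; apply: IHb => //; apply: IHb'.
Qed.

Definition emitb (b : bexp) : cmd := ifb b (Emit true) (Emit false).

Lemma eval_emitb n adj b e : eval n adj (emitb b) e = [:: beval adj b e].
Proof. by rewrite eval_ifb; case: beval. Qed.

(* [(c, ps, r)] stands for the equations [sum of X_p over p in ps = r], one for
   each triple of vertices (loop variables 0, 1, 2) satisfying [c]. *)
Definition scheme : Type := (bexp * seq (nat * nat) * bool)%type.

(* The loop variables 3 and 4 range over the index pairs of the unknowns. *)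
Definition row_exp (s : scheme) : bexp :=
  BAnd s.1.1
    (foldr (fun p => BXor (BAnd (BEq 3 p.1) (BEq 4 p.2))) (BConst false) s.1.2).

(** A triple that fails the condition yields the equation [0 = 0] rather than none. The number of
    equations thus depends only on [n] and the list of schemes, and can be written before any
    condition is tested. *)
Definition rhs_exp (s : scheme) : bexp := BAnd s.1.1 (BConst s.2).

Definition wf_scheme (s : scheme) : bool :=
  bwf [:: 2; 1; 0] s.1.1 && all (fun p => (p.1 < 3) && (p.2 < 3)) s.1.2.

Definition for_triples (l : seq scheme) (g : scheme -> cmd) : cmd :=
  For 0 (For 1 (For 2 (foldr (fun s => Then (g s)) Skip l))).

Definition for_pairs (c : cmd) : cmd := For 3 (For 4 c).

Definition emit_eq (s : scheme) : cmd :=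
  Then (for_pairs (emitb (row_exp s))) (emitb (rhs_exp s)).

Definition emit_system (l : seq scheme) : cmd :=
  Then (for_triples l (fun=> Emit true)) (Then (Emit false)
    (Then (for_pairs (Emit true)) (Then (Emit false) (for_triples l emit_eq)))).

Definition env3 (u v w : nat) : nat -> nat :=
  upd (upd (upd (fun=> 0) 0 u.+1) 1 v.+1) 2 w.+1.

Definition env5 (e : nat -> nat) (a b : nat) : nat -> nat :=
  upd (upd e 3 a.+1) 4 b.+1.

Definition instances (n : nat) (l : seq scheme) : seq (scheme * (nat -> nat)) :=
  flatten [seq flatten [seq flatten [seq [seq (s, env3 u v w) | s <- l]
    | w <- iota 0 n] | v <- iota 0 n] | u <- iota 0 n].

Definition row_of (n : nat) (adj : nat -> nat -> bool) (s : scheme)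
    (e : nat -> nat) : seq bool :=
  [seq beval adj (row_exp s) (env5 e a b) | a <- iota 0 n, b <- iota 0 n].

Definition equation_of (n : nat) (adj : nat -> nat -> bool)
    (p : scheme * (nat -> nat)) : seq bool * bool :=
  (row_of n adj p.1 p.2, beval adj (rhs_exp p.1) p.2).

Lemma flatten_map_flatten (S T : Type) (f : S -> seq T) ss :
  flatten [seq f x | x <- flatten ss] = flatten [seq flatten (map f s) | s <- ss].
Proof. by elim: ss => //= s ss IH; rewrite map_cat flatten_cat IH. Qed.

Lemma eval_for_triples n adj l g : eval n adj (for_triples l g) (fun=> 0) =
  flatten [seq eval n adj (g p.1) p.2 | p <- instances n l].
Proof.
rewrite /instances flatten_map_flatten -map_comp /=.
congr flatten; apply: eq_map => u /=; rewrite flatten_map_flatten -map_comp /=.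
congr flatten; apply: eq_map => v /=; rewrite flatten_map_flatten -map_comp /=.
congr flatten; apply: eq_map => w /=; rewrite -map_comp /=.
by elim: l => //= s l ->.
Qed.

Lemma flatten_seq1 (S T : Type) (f : S -> T) s :
  flatten [seq [:: f x] | x <- s] = map f s.
Proof. by elim: s => //= x s ->. Qed.

Lemma eval_emit_eq n adj s e : eval n adj (emit_eq s) e =
  rcons (row_of n adj s e) (beval adj (rhs_exp s) e).
Proof.
rewrite /= !eval_emitb cats1; congr rcons; congr flatten; apply: eq_map => a.
by under eq_map => b do rewrite eval_emitb; rewrite flatten_seq1.
Qed.

Lemma map_cst (S T : Type) (x : T) (s : seq S) : [seq x | _ <- s] = nseq (size s) x.
Proof. by elim: s => //= y s ->. Qed.

Lemma eval_emit_system n adj l (eqs := map (equation_of n adj) (instances n l)) :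
  eval n adj (emit_system l) (fun=> 0) =
    nseq (size eqs) true ++ false :: nseq (n * n) true ++ false ::
    flatten [seq rcons q.1 q.2 | q <- eqs].
Proof.
have evalT c d e : eval n adj (Then c d) e = eval n adj c e ++ eval n adj d e by [].
have evalE b e : eval n adj (Emit b) e = [:: b] by [].
rewrite /emit_system !evalT !evalE !eval_for_triples; congr (_ ++ _ :: _ ++ _ :: _).
- by under eq_map => p do rewrite evalE; rewrite flatten_seq1 map_cst size_map.
- rewrite /=; under eq_map => a do rewrite flatten_seq1 map_cst size_iota.
  rewrite map_cst size_iota; elim: {1 3}n => //= k ->.
  by rewrite mulSn nseqD.
- by rewrite -map_comp; congr flatten; apply: eq_map => p; rewrite eval_emit_eq.
Qed.

Definition system_of (nv : nat) (eqs : seq (seq bool * bool)) : z2system :=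
  @Z2System (size eqs) nv
    (\matrix_(i, j) (nth false (nth ([::], false) eqs i).1 j)%:R)%R
    (\col_i (nth ([::], false) eqs i).2%:R)%R.

Lemma F2_bool_eq1 (b : bool) : ((b%:R : 'F_2) == 1)%R = b.
Proof. by case: b. Qed.

Lemma F2_bool (x : 'F_2) : x = ((x == 1)%R%:R)%R.
Proof. by apply/val_inj; case: x => -[|[|]]. Qed.

Lemma F2_addb (a b : bool) : ((a (+) b)%:R = a%:R + b%:R :> 'F_2)%R.
Proof. by apply/val_inj; case: a b => [] []. Qed.

Lemma enc_system_of nv eqs : all (fun q => size q.1 == nv) eqs ->
  enc_z2system (system_of nv eqs) =
    nseq (size eqs) true ++ false :: nseq nv true ++ false ::
    flatten [seq rcons q.1 q.2 | q <- eqs].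
Proof.
move=> /(all_nthP ([::], false)) sz; rewrite /enc_z2system /=.
congr (_ ++ _ :: _ ++ _ :: flatten _).
apply: (@eq_from_nth _ [::]); rewrite size_map size_enum_ord ?size_map //.
move=> i lt_i; pose i' := Ordinal lt_i.
rewrite (nth_map i') ?size_enum_ord // (nth_map ([::], false)) //.
rewrite (nth_ord_enum i' i') /= mxE F2_bool_eq1; congr rcons.
have szi := eqP (sz i lt_i).
apply: (@eq_from_nth _ false); rewrite size_map size_enum_ord ?szi // => j lt_j.
rewrite (nth_map (Ordinal lt_j)) ?size_enum_ord //.
by rewrite (nth_ord_enum _ (Ordinal lt_j)) /= mxE F2_bool_eq1.
Qed.

Lemma solvable_system_of nv eqs : z2_solvable (system_of nv eqs) <->
  exists xi : nat -> bool, forall q, q \in eqs ->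
    (\sum_(j < nv) (nth false q.1 j && xi j)%:R = q.2%:R :> 'F_2)%R.
Proof.
have andF (a b : bool) : ((a && b)%:R = a%:R * b%:R :> 'F_2)%R.
  by rewrite -mulnb GRing.natrM.
split=> [[x eq_x]|[xi eq_xi]].
  exists (fun j => if insub j is Some j' then x j' ord0 == 1%R else false) => q q_eqs.
  have lt_q : index q eqs < size eqs by rewrite index_mem.
  have := congr1 (fun M : 'cV_(size eqs) => M (Ordinal lt_q) ord0) eq_x.
  rewrite !mxE /= nth_index // => <-; apply: eq_bigr => j _.
  by rewrite !mxE /= nth_index // andF valK -F2_bool.
exists (\col_j (xi j)%:R)%R; apply/matrixP => i k; rewrite !mxE.
have := eq_xi (nth ([::], false) eqs i); rewrite mem_nth // => /(_ isT) <-.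
by apply: eq_bigr => j _; rewrite !mxE andF.
Qed.

Lemma bwf_sub bnd bnd' b : {subset bnd <= bnd'} -> bwf bnd b -> bwf bnd' b.
Proof.
move=> sub; elim: b => [c|x y|x y|b IHb|b IHb b' IHb'|b IHb b' IHb'] //=.
- by case/and3P=> /sub -> /sub -> ->.
- by case/andP=> /sub -> /sub ->.
- by case/andP=> /IHb -> /IHb' ->.
- by case/andP=> /IHb -> /IHb' ->.
Qed.

Lemma beval_eq_in adj bnd b e e' : bwf bnd b -> {in bnd, e =1 e'} ->
  beval adj b e = beval adj b e'.
Proof.
move=> wb ee; elim: b wb => [c|x y|x y|b IHb|b IHb b' IHb'|b IHb b' IHb'] //=.
- by case/and3P=> /ee -> /ee ->.
- by case/andP=> /ee -> /ee ->.
- by move=> /IHb ->.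
- by case/andP=> /IHb -> /IHb' ->.
- by case/andP=> /IHb -> /IHb' ->.
Qed.

Lemma wf_emit_system l : all wf_scheme l -> wf [::] (emit_system l).
Proof.
move=> wf_l.
have wfT bnd c d : wf bnd (Then c d) = wf bnd c && wf bnd d by [].
have wfl g : all (fun s => wf [:: 2; 1; 0] (g s)) l -> wf [::] (for_triples l g).
  by rewrite /=; elim: (l) => //= s l' IH /andP[->].
rewrite /emit_system !wfT !wfl //; last by elim: (l).
apply: sub_all wf_l => -[[c ps] r] /andP[/= wc wps].
have wc' : bwf [:: 4; 3; 2; 1; 0] c.
  by apply: bwf_sub wc => x; rewrite !inE => /or3P[]/eqP->.
apply/andP; split; apply: wf_ifb => //=; last by rewrite wc.
rewrite wc' /=; elim: ps wps => //= -[p q] ps IH /andP[/= /andP[lt_p3 lt_q3] /IH ->].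
by case: p q lt_p3 lt_q3 => [|[|[|]]] // [|[|[|]]].
Qed.

Definition scheme_holds (n : nat) (adj : nat -> nat -> bool) (xi : nat -> bool)
    (s : scheme) (e : nat -> nat) : Prop :=
  beval adj s.1.1 e ->
  foldr (fun p b => xi ((e p.1).-1 * n + (e p.2).-1) (+) b) false s.1.2 = s.2.

(** Unknown number [k] belongs to the pair [(k %/ n, k %% n)], so at most one term of the sum is
    nonzero. *)
Lemma sum_delta n (xi : nat -> bool) i j : 0 < i <= n -> 0 < j <= n ->
  (\sum_(k < n * n) (((k %/ n).+1 == i) && ((k %% n).+1 == j) && xi k)%:R =
    (xi (i.-1 * n + j.-1))%:R :> 'F_2)%R.
Proof.
move=> hi hj; have lt_ij : i.-1 * n + j.-1 < n * n by nia.
rewrite (bigD1 (Ordinal lt_ij)) //= big1 => [|k].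
  rewrite GRing.addr0 divnMDl ?modnMDl; last by lia.
  rewrite divn_small ?modn_small; [|lia|lia].
  by rewrite addn0 !prednK ?eqxx //; lia.
move=> /eqP neq_k; rewrite -andbA; case: eqP => // ki; case: eqP => // kj; case: neq_k.
by apply/val_inj; rewrite /= -ki -kj /= -divn_eq.
Qed.

(** The condition mentions only the loop variables 0, 1 and 2, so it has the same value in every
    column. If it fails, both sides vanish; otherwise the row is a sum over $\mathbb Z_2$ of
    indicators, one for each listed pair, and each picks out one unknown. *)
Lemma equation_of_holds n adj (xi : nat -> bool) s e : wf_scheme s ->
  (forall x, x < 3 -> 0 < e x <= n) ->
  (\sum_(j < n * n) (nth false (equation_of n adj (s, e)).1 j && xi j)%:R =
    (equation_of n adj (s, e)).2%:R :> 'F_2)%R <-> scheme_holds n adj xi s e.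
Proof.
case: s => [[c ps] r] /andP[/= wc wps] he; rewrite /scheme_holds /=.
have env5E a b x : x < 3 -> env5 e a b x = e x by case: x => [|[|[|]]].
have rowE (j : 'I_(n * n)) : nth false (row_of n adj (c, ps, r) e) j =
    beval adj (row_exp (c, ps, r)) (env5 e (j %/ n) (j %% n)).
  have n_gt0 : 0 < n by case: j => j; case: (n).
  have := @nth_allpairs _ _ _ 0 0 false
    (fun a b => beval adj (row_exp (c, ps, r)) (env5 e a b))
    (iota 0 n) (iota 0 n) (j %/ n) (j %% n).
  rewrite !size_iota -divn_eq !nth_iota ?ltn_mod //; last by rewrite ltn_divLR.
  by apply; rewrite ?ltn_divLR ?ltn_mod.
under eq_bigr => j _ do rewrite rowE /=.
have cE a b : beval adj c (env5 e a b) = beval adj c e.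
  by apply: beval_eq_in wc _ => x; rewrite !inE => /or3P[]/eqP->; rewrite env5E.
under eq_bigr => j _ do rewrite cE.
case: (beval adj c e); last first.
  by rewrite big1.
suff -> : (\sum_(j < n * n) (true && beval adj
    (foldr (fun p => BXor (BAnd (BEq 3 p.1) (BEq 4 p.2))) (BConst false) ps)
    (env5 e (j %/ n) (j %% n)) && xi j)%:R =
    (foldr (fun p b => xi ((e p.1).-1 * n + (e p.2).-1) (+) b) false ps)%:R :> 'F_2)%R.
  split=> [eq_r _|-> //].
  by rewrite -[LHS]F2_bool_eq1 eq_r F2_bool_eq1.
elim: ps wps {rowE} => [_|[p q] ps IH /andP[/= /andP[lt_p lt_q] wps]].
  by rewrite big1.
(* As the indicators are combined by exclusive or, a pair occurring twice cancels, just as in the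
   sum; this happens in the symmetry equations when [u = v]. *)
rewrite /= F2_addb -IH // -sum_delta ?he // -big_split; apply: eq_bigr => j _ /=.
by rewrite -F2_addb (env5E _ _ p) // (env5E _ _ q) // andb_addl.
Qed.

(** Schemes are not given an equality test, so membership in a list of them is expressed by
    [List.In]. *)
Lemma mem_map_In (S : Type) (T : eqType) (f : S -> T) s y :
  y \in map f s <-> exists2 x, List.In x s & y = f x.
Proof.
elim: s => [|x s [IH IH']]; first by split=> // -[].
rewrite /= inE; split=> [/orP[/eqP ->|/IH[x' sx' ->]]|[x' [<-|sx'] yE]].
- by exists x; [left|].
- by exists x'; [right|].
- by rewrite yE eqxx.
- by apply/orP; right; apply: IH'; exists x'.
Qed.

Lemma mem_equations n adj l q :
  q \in map (equation_of n adj) (instances n l) <-> exists u v w,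
    [/\ u < n, v < n, w < n &
      exists2 s, List.In s l & q = equation_of n adj (s, env3 u v w)].
Proof.
have mapE : map (equation_of n adj) (instances n l) =
    flatten [seq flatten [seq flatten [seq
      [seq equation_of n adj (s, env3 u v w) | s <- l]
    | w <- iota 0 n] | v <- iota 0 n] | u <- iota 0 n].
  rewrite /instances map_flatten -map_comp; congr flatten; apply: eq_map => u /=.
  rewrite map_flatten -map_comp; congr flatten; apply: eq_map => v /=.
  rewrite map_flatten -map_comp; congr flatten; apply: eq_map => w /=.
  by rewrite -map_comp.
rewrite mapE; split.
  case/flatten_mapP=> u + /flatten_mapP[v + /flatten_mapP[w + /mem_map_In]].
  by rewrite !mem_iota => hu hv hw; exists u, v, w.
case=> u [v [w [hu hv hw hq]]].
apply/flatten_mapP; exists u; first by rewrite mem_iota.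
apply/flatten_mapP; exists v; first by rewrite mem_iota.
apply/flatten_mapP; exists w; first by rewrite mem_iota.
exact/mem_map_In.
Qed.

Lemma solvable_instances n adj l : all wf_scheme l ->
  z2_solvable (system_of (n * n) (map (equation_of n adj) (instances n l))) <->
  exists xi : nat -> bool, forall u v w, u < n -> v < n -> w < n ->
    forall s, List.In s l -> scheme_holds n adj xi s (env3 u v w).
Proof.
move=> wf_l; rewrite solvable_system_of.
have wfs s : List.In s l -> wf_scheme s.
  by elim: (l) wf_l => //= s' l' IH /andP[ws' /IH wl'] [<-|].
have env_n u v w : u < n -> v < n -> w < n -> forall x, x < 3 -> 0 < env3 u v w x <= n.
  by move=> hu hv hw [|[|[|]]].
split=> -[xi hxi]; exists xi.
  move=> u v w hu hv hw s ls.
  apply/equation_of_holds; [exact: wfs | exact: env_n |].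
  by apply: hxi; apply/mem_equations; exists u, v, w; split=> //; exists s.
move=> q /mem_equations[u [v [w [hu hv hw [s ls ->]]]]].
by apply/equation_of_holds; [exact: wfs | exact: env_n | exact: hxi].
Qed.

Definition graph_system (l : seq scheme) (G : graph) : z2system :=
  system_of (order G * order G)
    (map (equation_of (order G) (adj_nat G)) (instances (order G) l)).

Lemma poly_time_graph_system l : all wf_scheme l ->
  poly_time_computable enc_graph enc_z2system (graph_system l).
Proof.
move=> wf_l; apply: poly_time_eval (wf_emit_system wf_l) _ => G.
rewrite eval_emit_system enc_system_of //; apply/allP => q.
case/mem_equations=> u [v [w [_ _ _ [s _ ->]]]].
by rewrite size_allpairs size_iota.
Qed.

(** * Coloured graphs on three vertices *)

Lemma ec_iso_refl (V : finType) (K : ecgraph V) : ec_iso K K.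
Proof. by exists id => //; exists id. Qed.

Lemma ec_iso_sym (V W : finType) (K : ecgraph V) (H : ecgraph W) :
  ec_iso K H -> ec_iso H K.
Proof.
case=> f [g fK gK] fE; exists g; first by exists f.
by move=> u v; rewrite -fE !gK.
Qed.

Lemma ec_iso_trans (V W U : finType) (K : ecgraph V) (H : ecgraph W) (L : ecgraph U) :
  ec_iso K H -> ec_iso H L -> ec_iso K L.
Proof.
case=> f bij_f fE [g bij_g gE]; exists (g \o f); first exact: bij_comp.
by move=> u v; rewrite /= gE.
Qed.

Notation v0 := (@Ordinal 3 0 isT).
Notation v1 := (@Ordinal 3 1 isT).
Notation v2 := (@Ordinal 3 2 isT).

Lemma ord3P (P : 'I_3 -> Prop) : P v0 -> P v1 -> P v2 -> forall i, P i.
Proof.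
move=> P0 P1 P2 [[|[|[|i]]] lt_i] //.
- by have -> : Ordinal lt_i = v0 by apply/val_inj.
- by have -> : Ordinal lt_i = v1 by apply/val_inj.
- by have -> : Ordinal lt_i = v2 by apply/val_inj.
Qed.

Lemma ecgraph3E (H : ecgraph3) i j : H i j = ec3 (H v0 v1) (H v1 v2) (H v0 v2) i j.
Proof.
elim/ord3P: j; elim/ord3P: i; rewrite /= /ec3_fun /= ?ecol_irr //;
  by rewrite ecol_sym.
Qed.

(** Exchanging the vertices 0 and 2 swaps the pairs 01 and 12 and fixes 02. Together with
    [ec3_swap_r] this generates all permutations of the three pairs. *)
Lemma ec3_swap_l a b c : ec_iso (ec3 a b c) (ec3 b a c).
Proof.
exists (tperm v0 v2); first exact: injF_bij (@perm_inj _ _).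
by move=> i j; elim/ord3P: j; elim/ord3P: i; rewrite !permE.
Qed.

Lemma ec3_swap_r a b c : ec_iso (ec3 a b c) (ec3 a c b).
Proof.
exists (tperm v0 v1); first exact: injF_bij (@perm_inj _ _).
by move=> i j; elim/ord3P: j; elim/ord3P: i; rewrite !permE.
Qed.

Lemma ec3_iso_perm a b c a' b' c' : ec_iso (ec3 a b c) (ec3 a' b' c') ->
  List.In (a, b, c) [:: (a', b', c'); (b', a', c'); (a', c', b'); (c', b', a');
                        (b', c', a'); (c', a', b')].
Proof.
case=> f /bij_inj inj_f fE.
have := fE v0 v1; have := fE v1 v2; have := fE v0 v2.
have : f v0 != f v1 by rewrite (inj_eq inj_f).
have : f v1 != f v2 by rewrite (inj_eq inj_f).
have : f v0 != f v2 by rewrite (inj_eq inj_f).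
rewrite /= /ec3_fun.
elim/ord3P: (f v0); elim/ord3P: (f v1); elim/ord3P: (f v2) => //= _ _ _ <- <- <-;
  by intuition.
Qed.

Definition col (b : bool) : option colour := Some (if b then Red else Blue).

(** All members of [F] have three vertices, so a forbidden induced subgraph lives on three distinct
    vertices and is determined up to isomorphism by the statuses of their three pairs. *)
Lemma F_free_triples F (V : finType) (K : ecgraph V) : F_free F K <->
  forall u v w, u != v -> v != w -> u != w ->
    ~ ec_mem (ec3 (K u v) (K v w) (K u w)) F.
Proof.
split=> [freeK u v w uv vw uw [H FH iso_H]|ok S H FH [f [g fK gK] fE]].
  pose h (i : 'I_3) := match val i with 0 => u | 1 => v | _ => w end.
  have inj_h : injective h.
    apply: ord3P => i; elim/ord3P: i => //= E; exfalso; move: E uv vw uw;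
      by rewrite /h /= => ->; rewrite eqxx.
  have hS i : h i \in [set h j | j : 'I_3] by apply: imset_f.
  pose h' i : {x | x \in [set h j | j : 'I_3]} := exist _ (h i) (hS i).
  apply: (freeK [set h j | j : 'I_3] H FH); apply: ec_iso_trans iso_H.
  apply: ec_iso_sym; exists h'.
    apply: inj_card_bij; first by move=> i j [] /inj_h.
    by rewrite card_sig card_imset // card_ord.
  move=> i j; rewrite [LHS]/=.
  elim/ord3P: j; elim/ord3P: i; rewrite /= /ec3_fun /= ?ecol_irr //;
    by rewrite /h /= ecol_sym.
have neq_g i j : i != j -> val (g i) != val (g j).
  by move=> neq_ij; rewrite val_eqE (inj_eq (can_inj gK)).
apply: (ok (val (g v0)) (val (g v1)) (val (g v2))); try exact: neq_g.
exists H => //; exists id; first by exists id.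
have HE i j : K (val (g i)) (val (g j)) = H i j by have /= := fE (g i) (g j); rewrite !gK.
by move=> i j; rewrite !HE -ecgraph3E.
Qed.

Lemma ec_mem_iso F H H' : ec_iso H H' -> ec_mem H F -> ec_mem H' F.
Proof.
by move=> /ec_iso_sym iso_H [H'' FH'' iso_H'']; exists H''; last exact: ec_iso_trans iso_H''.
Qed.

Lemma ec_mem_swap_l F a b c : ec_mem (ec3 a b c) F -> ec_mem (ec3 b a c) F.
Proof. exact/ec_mem_iso/ec3_swap_l. Qed.

Lemma ec_mem_swap_r F a b c : ec_mem (ec3 a b c) F -> ec_mem (ec3 a c b) F.
Proof. exact/ec_mem_iso/ec3_swap_r. Qed.

(** [rK3] and [rbbK3] are the triangles with an odd number of red edges, [bK3] and [rrbK3] those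
    with an even number. Forbidding one class prescribes the parity [t] of the other. *)
Lemma triangle_mem F (hK3 : triangles_are F rK3 rbbK3 \/ triangles_are F bK3 rrbK3) :
  exists t, forall x y z,
    ~ ec_mem (ec3 (col x) (col y) (col z)) F <-> x (+) (y (+) z) = t.
Proof.
have tri x y z : is_triangle (ec3 (col x) (col y) (col z)).
  by apply: ord3P; apply: ord3P.
case: hK3 => hK; [exists false | exists true] => x y z;
  rewrite (hK _ (tri x y z)); (split=> [no_iso|xyz [/ec3_iso_perm|/ec3_iso_perm]]).
2,3: by rewrite /col; case: x y z xyz => [] [] [] //= _; intuition congruence.
3,4: by rewrite /col; case: x y z xyz => [] [] [] //= _; intuition congruence.
- case: x y z no_iso => [] [] [] //= no_iso; case: no_iso.
  + by left; apply: ec_iso_refl.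
  + by right; apply: ec_iso_refl.
  + by right; apply: ec3_swap_l.
  + by right; apply: ec_iso_trans (ec3_swap_r _ _ _) (ec3_swap_l _ _ _).
- case: x y z no_iso => [] [] [] //= no_iso; case: no_iso.
  + by right; apply: ec_iso_refl.
  + by right; apply: ec3_swap_r.
  + by right; apply: ec_iso_trans (ec3_swap_l _ _ _) (ec3_swap_r _ _ _).
  + by left; apply: ec_iso_refl.
Qed.

(** Membership in the arbitrary predicate [F] is decided classically. The resulting Booleans depend
    on [F] alone, so they can be built into the program as constants. *)
Lemma decide (P : Prop) : exists b : bool, P <-> b.
Proof. by case: (classic P) => hP; [exists true | exists false]. Qed.

(** If [rbP3] is forbidden, the two edges agree, and a forbidden monochromatic path excludes its
    colour. Otherwise both monochromatic paths are forbidden and the edges differ. *)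
Lemma path_mem F (hP3 : ec_mem rbP3 F \/ (ec_mem rP3 F /\ ec_mem bP3 F)) :
  exists prb pr pb : bool, forall x y,
    ~ ec_mem (ec3 (col x) (col y) None) F <->
    [/\ x (+) y = ~~ prb, pr -> x = false & pb -> x = true].
Proof.
have [prb hprb] := decide (ec_mem rbP3 F).
have [pr hpr] := decide (ec_mem rP3 F); have [pb hpb] := decide (ec_mem bP3 F).
(* Masking with [prb] drops the colour restrictions in the second case, where the first edge may
   have either colour. *)
exists prb, (prb && pr), (prb && pb) => x y.
have hbr : ec_mem (ec3 (col false) (col true) None) F <-> prb.
  by rewrite -hprb; split; apply: ec_mem_swap_l.
have {}hP3 : prb || pr && pb.
  by case: hP3 => [/hprb -> //|[/hpr -> /hpb ->]]; apply: orbT.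
case: x y => [] []; rewrite -/rP3 -/rbP3 -/bP3.
- rewrite hpr; split=> [/negP|[] /= + + _ mem]; rewrite ?mem.
    by move: hP3; case: (prb) (pr) (pb) => [] [] [].
  by case: (prb) => // _ /(_ isT).
- rewrite hprb; split=> [/negP|[] /= + _ _ mem]; rewrite ?mem //.
  by move: hP3; case: (prb) (pr) (pb) => [] [] [].
- rewrite hbr; split=> [/negP|[] /= + _ _ mem]; rewrite ?mem //.
  by move: hP3; case: (prb) (pr) (pb) => [] [] [].
- rewrite hpb; split=> [/negP|[] /= + _ + mem]; rewrite ?mem.
    by move: hP3; case: (prb) (pr) (pb) => [] [] [].
  by case: (prb) => // _ /(_ isT).
Qed.

Lemma edge_mem F : exists er eb : bool, forall x,
  ~ ec_mem (ec3 (col x) None None) F <-> (er -> x = false) /\ (eb -> x = true).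
Proof.
have [er her] := decide (ec_mem (ec3 (col true) None None) F).
have [eb heb] := decide (ec_mem (ec3 (col false) None None) F).
by exists er, eb; case; rewrite ?her ?heb; case: er eb {her heb} => [] []; intuition.
Qed.

(** * The equations of the [F]-free colouring problem *)

Definition cond_path : bexp :=
  BAnd (BAdj 0 1) (BAnd (BAdj 1 2) (BAnd (BNot (BAdj 0 2)) (BNot (BEq 0 2)))).

(** Adjacent vertices are distinct, so here, as in [cond_path], only the non-adjacent pairs get an
    equality test. *)
Definition cond_edge : bexp :=
  BAnd (BAdj 0 1) (BAnd (BNot (BAdj 1 2)) (BAnd (BNot (BAdj 0 2))
    (BAnd (BNot (BEq 0 2)) (BNot (BEq 1 2))))).

Definition cond_empty : bexp :=
  BAnd (BNot (BAdj 0 1)) (BAnd (BNot (BAdj 1 2)) (BAnd (BNot (BAdj 0 2))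
    (BAnd (BNot (BEq 0 1)) (BAnd (BNot (BEq 0 2)) (BNot (BEq 1 2)))))).

(** The first scheme makes the unknowns symmetric. The last has an empty left-hand side: if $3K_1$
    is forbidden, an independent triple contributes [0 = 1]. *)
Definition schemes (t prb pr pb er eb em : bool) : seq scheme :=
  [:: (BConst true, [:: (0, 1); (1, 0)], false);
      (BAnd (BAdj 0 1) (BAnd (BAdj 1 2) (BAdj 0 2)), [:: (0, 1); (1, 2); (0, 2)], t);
      (cond_path, [:: (0, 1); (1, 2)], ~~ prb);
      (BAnd cond_path (BConst pr), [:: (0, 1)], false);
      (BAnd cond_path (BConst pb), [:: (0, 1)], true);
      (BAnd cond_edge (BConst er), [:: (0, 1)], false);
      (BAnd cond_edge (BConst eb), [:: (0, 1)], true);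
      (BAnd cond_empty (BConst em), [::], true)].

Definition respects (t prb pr pb er eb em : bool) (G : graph)
    (X : 'I_(order G) -> 'I_(order G) -> bool) (u v w : 'I_(order G)) : Prop :=
  [/\ X u v = X v u,
    G u v -> G v w -> G u w -> X u v (+) (X v w (+) X u w) = t,
    G u v -> G v w -> ~~ G u w -> u != w ->
      [/\ X u v (+) X v w = ~~ prb, pr -> X u v = false & pb -> X u v = true],
    G u v -> ~~ G v w -> ~~ G u w -> u != w -> v != w ->
      (er -> X u v = false) /\ (eb -> X u v = true) &
    ~~ G u v -> ~~ G v w -> ~~ G u w -> u != v -> u != w -> v != w -> em = false].

Lemma forall_In_cons (S : Type) (x : S) s (P : S -> Prop) :
  (forall y, List.In y (x :: s) -> P y) <-> P x /\ (forall y, List.In y s -> P y).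
Proof.
split=> [h|[Px h] y [<-|]]; [split=> [|y sy]; apply: h; [left|right] | |] => //.
exact: h.
Qed.

Lemma schemes_hold t prb pr pb er eb em (G : graph) (xi : nat -> bool)
    (u v w : 'I_(order G)) :
  (forall s, List.In s (schemes t prb pr pb er eb em) ->
     scheme_holds (order G) (adj_nat G) xi s (env3 u v w)) <->
  respects t prb pr pb er eb em (fun a b => xi (a * order G + b)) u v w.
Proof.
rewrite /schemes !forall_In_cons /scheme_holds /= ?addbF !adj_nat_ord !eqSS !val_eqE.
split=> [[h1 [h2 [h3 [h4 [h5 [h6 [h7 [h8 _]]]]]]]]|[h1 h2 h3 h4 h5]].
  split.
  - by move: (h1 isT); do 2 case: (xi _).
  - by move=> uv vw uw; apply: h2; rewrite uv vw uw.
  - by move=> uv vw uw u_w; rewrite uv vw uw u_w /= in h3 h4 h5; split=> //; apply: h3.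
  - by move=> uv vw uw u_w v_w; rewrite uv vw uw u_w v_w /= in h6 h7.
  - move=> uv vw uw u_v u_w v_w; rewrite uv vw uw u_v u_w v_w /= in h8.
    by apply/negP => /h8.
split; first by rewrite h1 addbb.
split; first by case/and3P.
split; first by case/and4P=> uv vw uw u_w; case: h3.
split; first by case/andP=> /and4P[uv vw uw u_w]; case: h3.
split; first by case/andP=> /and4P[uv vw uw u_w]; case: h3.
split; first by case/andP=> /and5P[uv vw uw u_w v_w]; case: h4.
split; first by case/andP=> /and5P[uv vw uw u_w v_w]; case: h4.
split=> // /andP[/and5P[uv vw uw u_v /andP[u_w v_w]]].
by rewrite h5.
Qed.

Lemma wf_schemes t prb pr pb er eb em : all wf_scheme (schemes t prb pr pb er eb em).
Proof. by []. Qed.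

Lemma solvable_graph_system t prb pr pb er eb em (G : graph) :
  z2_solvable (graph_system (schemes t prb pr pb er eb em) G) <->
  exists X, forall u v w : 'I_(order G), respects t prb pr pb er eb em X u v w.
Proof.
rewrite solvable_instances ?wf_schemes //; split=> [[xi hxi]|[X hX]].
  exists (fun a b : 'I_(order G) => xi (a * order G + b)) => u v w.
  by apply/schemes_hold => s; apply: hxi.
(* The number of an unknown is decoded by division with remainder; the defaults [false] do not arise
   for numbers that come from a pair of vertices. *)
pose xi j := if insub (j %/ order G) is Some a then
  if insub (j %% order G) is Some b then X a b else false else false.
exists xi => u v w hu hv hw.
have xiE : (fun a b : 'I_(order G) => xi (a * order G + b)) = X.
  apply: functional_extensionality => a; apply: functional_extensionality => b.
  have n_gt0 : 0 < order G by apply: leq_ltn_trans (ltn_ord a).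
  rewrite /xi divnMDl // modnMDl divn_small // modn_small // addn0.
  by rewrite !valK.
apply/(@schemes_hold _ _ _ _ _ _ _ G xi (Ordinal hu) (Ordinal hv) (Ordinal hw)).
by rewrite xiE.
Qed.

Lemma triples_respects F (t prb pr pb er eb em : bool) (G : graph) X
    (K : ecgraph 'I_(order G)) :
  (forall x y z, ~ ec_mem (ec3 (col x) (col y) (col z)) F <-> x (+) (y (+) z) = t) ->
  (forall x y, ~ ec_mem (ec3 (col x) (col y) None) F <->
    [/\ x (+) y = ~~ prb, pr -> x = false & pb -> x = true]) ->
  (forall x, ~ ec_mem (ec3 (col x) None None) F <->
    (er -> x = false) /\ (eb -> x = true)) ->
  (ec_mem (ec3 None None None) F <-> em) ->
  (forall u v, X u v = X v u) ->
  (forall u v, K u v = if G u v then col (X u v) else None) ->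
  F_free F K <-> forall u v w, respects t prb pr pb er eb em X u v w.
Proof.
move=> hT hP hE hN symX KE; rewrite F_free_triples.
have neq u v : G u v -> u != v by apply: contraTneq => ->; rewrite edge_irr.
split=> [ok u v w|hX u v w uv vw uw].
  split=> // [guv gvw guw|guv gvw guw uw|guv gvw guw uw vw|guv gvw guw uv uw vw].
  - have := ok u v w (neq _ _ guv) (neq _ _ gvw) (neq _ _ guw).
    by rewrite !KE guv gvw guw hT.
  - have := ok u v w (neq _ _ guv) (neq _ _ gvw) uw.
    by rewrite !KE guv gvw (negbTE guw) hP.
  - have := ok u v w (neq _ _ guv) vw uw.
    by rewrite !KE guv (negbTE gvw) (negbTE guw) hE.
  - have := ok u v w uv vw uw.
    by rewrite !KE (negbTE guv) (negbTE gvw) (negbTE guw) hN => /negP/negbTE.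
have [gvu gwv gwu] : [/\ G v u = G u v, G w v = G v w & G w u = G u w].
  by split; apply: edge_sym.
have [vu wv wu] : [/\ v != u, w != v & w != u] by split; rewrite eq_sym.
(* Each clause of [respects] treats one placement of the edges but is available for every ordering
   of the triple; swaps bring the other placements into that form. *)
rewrite !KE; case guv: (G u v); case gvw: (G v w); case guw: (G u w).
- by apply/hT; have [_ h _ _ _] := hX u v w; apply: h.
- by apply/hP; have [_ _ h _ _] := hX u v w; apply: h; rewrite ?guw.
- move/ec_mem_swap_r; apply/hP; rewrite symX.
  by have [_ _ h _ _] := hX v u w; apply: h; rewrite ?gvu ?gvw.
- move/ec_mem_swap_r; apply/hE.
  by have [_ _ _ h _] := hX u v w; apply: h; rewrite ?gvw ?guw.
- move/ec_mem_swap_l/ec_mem_swap_r; apply/hP; rewrite (symX u w).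
  by have [_ _ h _ _] := hX v w u; apply: h; rewrite ?gwu ?gvu ?guv.
- move/ec_mem_swap_l/ec_mem_swap_r; apply/hE.
  by have [_ _ _ h _] := hX v w u; apply: h; rewrite ?gwu ?gvu ?guw ?guv.
- move/ec_mem_swap_r/ec_mem_swap_l/ec_mem_swap_r; apply/hE.
  by have [_ _ _ h _] := hX u w v; apply: h; rewrite ?gwv ?guv ?gvw.
- rewrite hN; have [_ _ _ _ h] := hX u v w.
  by rewrite h ?guv ?gvw ?guw.
Qed.

Theorem lemma37 (F : ecgraph3 -> Prop)
  (hP3 : ec_mem rbP3 F \/ (ec_mem rP3 F /\ ec_mem bP3 F))
  (hK3 : triangles_are F rK3 rbbK3 \/ triangles_are F bK3 rrbK3) :
  exists f : graph -> z2system,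
    poly_time_computable enc_graph enc_z2system f /\
    forall G : graph, z2_solvable (f G) <-> F_free_colourable F G.
Proof.
have [t hT] := triangle_mem hK3; have [prb [pr [pb hP]]] := path_mem hP3.
have [er [eb hE]] := edge_mem F; have [em hN] := decide (ec_mem (ec3 None None None) F).
exists (graph_system (schemes t prb pr pb er eb em)).
split=> [|G]; first exact/poly_time_graph_system/wf_schemes.
rewrite solvable_graph_system; split=> [[X hX]|[K [colK freeK]]].
  have symX u v : X u v = X v u by have [] := hX u v v.
  pose k u v := if G u v then col (X u v) else None.
  have sym_k u v : k u v = k v u by rewrite /k edge_sym symX.
  have irr_k u : k u u = None by rewrite /k edge_irr.
  exists (ECGraph sym_k irr_k); split; first by move=> u v; rewrite /= /k; case: ifP.
  by apply/(triples_respects hT hP hE hN symX).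
(* Blue edges and non-edges both get [false]. On non-edges only the symmetry equations apply, and
   these hold because [K] is symmetric. *)
exists (fun u v => if K u v is Some Red then true else false).
move: freeK; apply (triples_respects hT hP hE hN) => u v; first by rewrite ecol_sym.
by have := colK u v; case: (K u v) => [[]|] <-.
Qed.
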